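(* Let $p\in\mathbb{N}$ and let $P$ and $Q$ be real monic polynomials with $\deg(P)=p$ and $\deg(Q)=p-1$, neither of which has a zero in $\mathbb{C}_+$. Let $(L_t)_{t\in\mathbb{R}}$ be a two-sided subordinator with non-zero Lévy measure and $\mathbb{E}[L_1]<\infty$, and let $(Y_t)_{t\in\mathbb{R}}$ be the causal and invertible CARMA($p,p-1$) process driven by $(L_t)_{t\in\mathbb{R}}$ with autoregressive polynomial $P$ and moving average polynomial $Q$. Let $R(z)=(z+\lambda)Q(z)-P(z)$, where $\lambda\in\mathbb{R}$ is the unique constant such that $\deg(R)<p-1$, and let $f:[0,\infty)\to\mathbb{R}$ be the function characterized by $$\int_0^\infty e^{-ity}f(t)\,\mathrm{d}t=\frac{R(iy)}{Q(iy)},\qquad y\in\mathbb{R}.$$ Then $(Y_t)_{t\in\mathbb{R}}$ is non-negative if $R/Q$ is completely monotone on $[0,\infty)$ or, equivalently, if the function $f$ is non-negative.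
   Context: $\mathbb{C}_+=\{z\in\mathbb{C}:\operatorname{Re}(z)\ge 0\}$. A two-sided subordinator is $L_t=L^1_t\mathbf{1}_{[0,\infty)}(t)-L^2_{(-t)-}\mathbf{1}_{(-\infty,0)}(t)$, $t\in\mathbb{R}$, where $L^1,L^2$ are independent processes with the same law, each starting at $0$ with càdlàg paths and stationary, independent, non-negative increments. CARMA process: for real monic polynomials $P(z)=z^p+a_1z^{p-1}+\cdots+a_p$ and $Q(z)=b_0+b_1z+\cdots+b_{q-1}z^{q-1}+z^q$ with $p>q$ and $P$ having no zeroes in $\mathbb{C}_+$ (causality), the causal CARMA($p,q$) process driven by $(L_t)_{t\in\mathbb{R}}$ is $$Y_t=\int_{-\infty}^t g(t-s)\,\mathrm{d}L_s,\quad t\in\mathbb{R},\qquad g(t)=\boldsymbol{b}^\top e^{\boldsymbol{A}t}\boldsymbol{e}_p,$$ where $\boldsymbol{A}\in\mathbb{R}^{p\times p}$ is the companion matrix with ones on the superdiagonal, last row $(-a_p,-a_{p-1},\dots,-a_1)$ and zeroes elsewhere, $\boldsymbol{b}=(b_0,\dots,b_{q-1},1,0,\dots,0)^\top\in\mathbb{R}^p$, and $\boldsymbol{e}_p=(0,\dots,0,1)^\top\in\mathbb{R}^p$. Equivalently, $\int_0^\infty e^{-ity}g(t)\,\mathrm{d}t=Q(iy)/P(iy)$ for $y\in\mathbb{R}$. It is called invertible if $Q$ has no zeroes in $\mathbb{C}_+$. The zero polynomial has degree $-\infty$. The function $f$ is taken to be the continuous function with the stated Fourier transform (a finite linear combination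 of polynomials times exponentials). A function $F$ is completely monotone on $[0,\infty)$ if $(-1)^nF^{(n)}(x)\ge0$ for all $x>0$ and $n\in\mathbb{N}_0$. ''$(Y_t)_{t\in\mathbb{R}}$ is non-negative'' means that $Y_t\ge0$ almost surely for each $t\in\mathbb{R}$. *)

(* Defs.v *)
From HB Require Import structures.
From mathcomp Require Import all_boot all_order all_algebra.
From mathcomp Require Import complex.
From mathcomp Require Import all_classical all_reals all_analysis.
Set Implicit Arguments.
Unset Strict Implicit.
Unset Printing Implicit Defensive.
Import Order.TTheory GRing.Theory Num.Theory.
Import numFieldNormedType.Exports.
Local Open Scope classical_set_scope.
Local Open Scope ring_scope.
Local Open Scope complex_scope.

(* A process is a map [X : R -> Omega -> R], [X t w] being its value at time [t]
   in state [w]. A process indexed by [0, +oo[ is such a map whose values at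
   negative times are irrelevant: no definition below looks at them. *)

Section subordinators.
Context {R : realType} {d : measure_display} {Omega : measurableType d}.
Variable Pr : probability Omega R.
Implicit Types X Y L : R -> Omega -> R.

Definition cadlag (x : R -> R) : Prop :=
  (forall t, 0 <= t -> x s @[s --> t^'+] --> x t) /\
  (forall t, 0 < t -> cvg (x s @[s --> t^'-])).

Definition stationary_increments X : Prop :=
  forall s h (B : set R), 0 <= s -> 0 <= h -> measurable B ->
    Pr ((X (s + h) \- X s) @^-1` B) = Pr ((X h \- X 0) @^-1` B).

(* Since some of the [B i] may be [setT], the product rule covers every
   subfamily of the increments. *)
Definition independent_increments X : Prop :=
  forall (n : nat) (t : nat -> R) (B : nat -> set R),
    0 <= t 0%N -> {homo t : i j / (i <= j)%N >-> i <= j} ->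
    (forall i, measurable (B i)) ->
    Pr (\bigcap_(i in `I_n) ((X (t i.+1) \- X (t i)) @^-1` B i)) =
    (\prod_(i < n) Pr ((X (t i.+1) \- X (t i))%R @^-1` B i))%E.

Record subordinator X : Prop := Subordinator {
  subordinator_measurable :
    forall t, 0 <= t -> measurable_fun [set: Omega] (X t);
  subordinator_start : {ae Pr, forall w, X 0 w = 0};
  subordinator_cadlag : {ae Pr, forall w, cadlag (X ^~ w)};
  subordinator_stationary : stationary_increments X;
  subordinator_independent : independent_increments X;
  subordinator_nonneg :
    forall s t, 0 <= s -> s <= t -> {ae Pr, forall w, 0 <= X t w - X s w} }.

(* The cylindrical sigma-algebra on the paths indexed by [0, +oo[ *)
Definition path_events : set (set (R -> R)) :=
  <<s \bigcup_(t in [set t : R | 0 <= t])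
        preimage_set_system [set: R -> R] (fun x => x t) measurable >>.

Definition path_preimage X (A : set (R -> R)) : set Omega :=
  [set w | A (X ^~ w)].

Definition same_law X Y : Prop :=
  forall A, path_events A -> Pr (path_preimage X A) = Pr (path_preimage Y A).

Definition independent_processes X Y : Prop :=
  forall A B, path_events A -> path_events B ->
    Pr (path_preimage X A `&` path_preimage Y B) =
    (Pr (path_preimage X A) * Pr (path_preimage Y B))%E.

Definition two_sided X1 X2 : R -> Omega -> R := fun t w =>
  if 0 <= t then X1 t w else - lim (X2 s w @[s --> (- t)^'-]).

Definition two_sided_subordinator L : Prop :=
  exists L1 L2, [/\ subordinator L1, subordinator L2, same_law L1 L2,
    independent_processes L1 L2 & L = two_sided L1 L2].

(* Levy-Khintchine representation of the law of [L 1]: [gamma] is the drift and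
   [nu] is the Levy measure of the subordinator [L]. *)
Definition drift_levy_measure L (gamma : R) (nu : {measure set R -> \bar R}) :
    Prop :=
  [/\ 0 <= gamma,
      nu `]-oo, 0]%classic = 0%E,
      (\int[nu]_(x in `]0%R, +oo[) (Num.min 1 x)%R%:E < +oo)%E &
      forall u : R, 0 <= u ->
        ('E_Pr[fun w => (expR (- (u * L 1 w)))%R])%E =
        (expR (- (gamma * u
                  + \int[nu]_(x in `]0, +oo[) (1 - expR (- (u * x))))))%:E].

Definition nonnegative_process Y : Prop :=
  forall t, {ae Pr, forall w, 0 <= Y t w}.

End subordinators.

Section carma.
Context {R : realType}.
Implicit Types P Q : {poly R}.

Definition mxexp n (A : 'M[R]_n) : 'M[R]_n :=
  \matrix_(i, j) limn (series (fun k => (A ^+ k) i j / k`!%:R)).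

Definition carma_kernel P Q (t : R) : R :=
  let p := (size P).-1 in
  let b : 'rV[R]_p := \row_j Q`_j in
  let e_p : 'cV[R]_p := \col_i (i == p.-1 :> nat)%:R in
  (b *m mxexp (t *: companionmx P) *m e_p) 0 0.

(* The paths of a subordinator being nondecreasing, the integral with respect
   to [L] is a pathwise (absolutely convergent) Lebesgue-Stieltjes integral. *)
Definition carma_process {d : measure_display} {Omega : measurableType d}
    (Pr : probability Omega R) P Q (L Y : R -> Omega -> R) : Prop :=
  forall t, {ae Pr, forall w, exists F : cumulative R R,
    [/\ (F : R -> R) = L ^~ w,
        (lebesgue_stieltjes_measure F).-integrable `]-oo, t]
          (fun s => (carma_kernel P Q (t - s))%:E) &
        Y t w = \int[lebesgue_stieltjes_measure F]_(s in `]-oo, t])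
                  carma_kernel P Q (t - s)]}.

Definition ceval P (z : R[i]) : R[i] := (map_poly (real_complex R) P).[z].

Definition no_zero_in_Cplus P : Prop :=
  forall z : R[i], 0 <= complex.Re z -> ceval P z != 0.

Definition remainder P Q (lambda : R) : {poly R} := ('X + lambda%:P) * Q - P.

Definition completely_monotone (F : R -> R) : Prop :=
  forall (n : nat) (x : R), 0 < x ->
    derivable (derive1n n F) x 1 /\ 0 <= (-1) ^+ n * derive1n n F x.

Definition cis (x : R) : R[i] := cos x +i* sin x.

Definition Cintegral {d : measure_display} {T : measurableType d}
    (mu : {measure set T -> \bar R}) (D : set T) (h : T -> R[i]) : R[i] :=
  (\int[mu]_(x in D) complex.Re (h x)) +i*
  (\int[mu]_(x in D) complex.Im (h x)).

Definition half_line_fourier (f : R -> R) (y : R) : R[i] :=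
  Cintegral lebesgue_measure `[0, +oo[ (fun t => cis (- (t * y)) * (f t)%:C).

End carma.

(* Main.v *)
Require Import Defs.
From HB Require Import structures.
From mathcomp Require Import all_boot all_order all_algebra.
From mathcomp Require Import complex.
From mathcomp Require Import all_classical all_reals all_analysis.
From mathcomp Require Import measurable_realfun.
From mathcomp Require polyrcf.
From mathcomp Require Import zify ring lra.
Import Order.TTheory GRing.Theory Num.Theory.
Import numFieldNormedType.Exports.
Local Open Scope classical_set_scope.
Local Open Scope ring_scope.
Local Open Scope complex_scope.
Set Implicit Arguments.
Unset Strict Implicit.
Unset Printing Implicit Defensive.

(** The kernel g of the process has Laplace transform Q / P, and R / Q is tied
    to it by P / Q = z + lambda - R / Q.  Everything follows from two facts.

    (1) A continuous integrable f on [0, +oo[ is non-negative if and only if its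
    Laplace transform is completely monotone ([bernstein_half_line]).  One
    direction differentiates under the integral sign: up to the sign (-1)^n, the
    n-th derivative at x is the integral of t^n e^(-xt) f(t).  For the other,
    the functions t^n e^(-nt/t0) concentrate around t0 as n grows, so that f
    cannot be negative at t0 while all those integrals are non-negative.

    (2) If R / Q is completely monotone then so is Q / P, being the reciprocal
    of B = x + lambda - R / Q: the derivative (1/B)' = - B' (1/B)^2 has a
    completely monotone B', and products of completely monotone functions are
    completely monotone ([cm_upto_recip], [completely_monotone_carma]).

    Fact (1) applied to f gives the equivalence, and applied to g it turns the
    complete monotonicity of Q / P into g >= 0.  As the paths of L are
    nondecreasing, Y is then an integral of a non-negative function against a
    measure.

    It remains to relate functions and transforms.  Both kernels have the form
    N(D) phi, where D is differentiation and phi is the solution of the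
    equation P(D) phi = 0 (Q(D) phi = 0 in the case of f) whose initial values
    are 0, ..., 0, 1; for g this is read off the companion matrix
    ([carma_kernelE]).  As all roots have negative real part, these functions
    decay exponentially ([diffop_exp_decay]).  An explicit antiderivative of
    e^(-zt) N(D) phi, obtained by dividing (N(z)/P(z)) P(X) - N(X) by X - z,
    then shows that the transform of N(D) phi at z is N(z) / P(z)
    ([rational_kernel_transform]).  The function f is known only through its
    Fourier transform; it equals R(D) phi on [0, +oo[ because an integrable
    continuous function whose cosine transform vanishes is zero
    ([eq0_of_cosine_transform]). *)


(** * Completely monotone functions *)

Section complete_monotonicity.
Context {R : realType}.
Implicit Types F G H : R -> R.

(** Complete monotonicity up to order [n], the function [G] being [- F'].
    Carrying the negated derivative keeps signs out of the closure properties,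
    and stopping at a finite order is what makes the reciprocal accessible to
    induction. *)
Fixpoint cm_upto (n : nat) F : Prop :=
  (forall x, 0 < x -> 0 <= F x) /\
  if n is m.+1 then
    exists2 G : R -> R,
      forall x : R, 0 < x -> is_derive x 1 F (- G x) & cm_upto m G
  else True.

Lemma cm_upto_ge0 n F : cm_upto n F -> forall x, 0 < x -> 0 <= F x.
Proof. by case: n => [|n] []. Qed.

Lemma near_gt0_eq F G (x : R) : 0 < x -> (forall y, 0 < y -> F y = G y) ->
  \near x, F x = G x.
Proof.
move=> x0 FG; near=> y; apply: FG.
by near: y; exact: lt_nbhsr.
Unshelve. all: by end_near. Qed.

Lemma eq_cm_upto n F G : (forall x, 0 < x -> F x = G x) ->
  cm_upto n F -> cm_upto n G.
Proof.
move=> FG; case: n => [|n] [F0 Fn].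
  by split=> // x x0; rewrite -FG// F0.
split=> [x x0|]; first by rewrite -FG// F0.
have [H dF Hn] := Fn; exists H => // x x0.
exact: near_eq_is_derive (near_gt0_eq x0 FG) (dF _ x0).
Qed.

Lemma cm_uptoW n F : cm_upto n.+1 F -> cm_upto n F.
Proof.
elim: n F => [|n IHn] F [F0 [G dF Gn]]; first by split.
by split=> //; exists G => //; exact: IHn.
Qed.

Lemma cm_upto_cst n (c : R) : 0 <= c -> cm_upto n (fun=> c).
Proof.
elim: n c => [|n IHn] c c0; first by split.
split=> //; exists (fun=> 0); last exact: IHn.
by move=> x _; rewrite oppr0; exact: is_derive_cst.
Qed.

Lemma cm_uptoD n F G : cm_upto n F -> cm_upto n G ->
  cm_upto n (fun x => F x + G x).
Proof.
elim: n F G => [|n IHn] F G [F0 Fn] [G0 Gn].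
  by split=> // x x0; rewrite addr_ge0 ?F0 ?G0.
split=> [x x0|]; first by rewrite addr_ge0 ?F0 ?G0.
have [F' dF F'n] := Fn; have [G' dG G'n] := Gn.
exists (fun x => F' x + G' x); last exact: IHn.
move=> x x0; rewrite opprD.
by have := dF _ x0; have := dG _ x0 => ? ?; exact: is_deriveD.
Qed.

Lemma cm_uptoM n F G : cm_upto n F -> cm_upto n G ->
  cm_upto n (fun x => F x * G x).
Proof.
elim: n F G => [|n IHn] F G Fn Gn.
  by split=> // x x0; rewrite mulr_ge0 ?(cm_upto_ge0 Fn) ?(cm_upto_ge0 Gn).
have FW := cm_uptoW Fn; have GW := cm_uptoW Gn.
case: Fn Gn => F0 [F' dF F'n] [G0 [G' dG G'n]].
split=> [x x0|]; first by rewrite mulr_ge0 ?F0 ?G0.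
exists (fun x => F' x * G x + F x * G' x).
  move=> x x0; have dFx := dF _ x0; have dGx := dG _ x0.
  apply: (@is_derive_eq _ _ _ (F * G)%R); rewrite /GRing.scale/=; ring.
by apply: cm_uptoD; exact: IHn.
Qed.

(** Derivatives being unique, the witnesses provided by the different orders
    agree on the positive half-line, so that one function serves them all. *)
Lemma cm_neg_derive F : (forall n, cm_upto n F) ->
  exists2 G : R -> R, forall x : R, 0 < x -> is_derive x 1 F (- G x)
    & forall n, cm_upto n G.
Proof.
move=> cmF; have [_ [G dF _]] := cmF 1%N; exists G => // n.
have [_ [H dH Hn]] := cmF n.+1; apply: eq_cm_upto Hn => x x0.
by apply: oppr_inj; have [_ <-] := dF _ x0; have [_ <-] := dH _ x0.
Qed.

(** With B = x + l - F, the opposite of (1/B)' is B' (1/B)^2, and B' is the sum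
    of 1 and of the opposite of the derivative of F, which is completely
    monotone; hence order [n] for 1/B gives order [n.+1]. *)
Lemma cm_upto_recip F (l : R) : (forall n, cm_upto n F) ->
  (forall x, 0 < x -> 0 < x + l - F x) ->
  forall n, cm_upto n (fun x => (x + l - F x)^-1).
Proof.
move=> cmF B0; have [_ [F' dF _]] := cmF 1%N.
have cmF' n : cm_upto n F'.
  have [_ [G dG Gn]] := cmF n.+1; apply: eq_cm_upto Gn => x x0.
  apply: oppr_inj; have [_ <-] := dF _ x0; by have [_ <-] := dG _ x0.
elim=> [|n IHn]; first by split=> // x x0; rewrite invr_ge0 ltW ?B0.
split=> [x x0|]; first by rewrite invr_ge0 ltW ?B0.
exists (fun x => (1 + F' x) * ((x + l - F x)^-1 * (x + l - F x)^-1)).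
  move=> x x0; have dFx := dF _ x0.
  have dB : is_derive x 1 (fun y : R => y + l - F y) (1 + F' x).
    by apply: is_derive_eq; rewrite addr0 opprK.
  apply: is_derive_eq; first by apply: is_deriveV; rewrite gt_eqF ?B0.
  by rewrite /GRing.scale/= -expr2 exprVn mulNr mulrC.
apply: cm_uptoM; last exact: cm_uptoM.
by apply: cm_uptoD => //; exact: cm_upto_cst.
Qed.

Lemma derive_sign k (f G : R -> R) (x : R) :
  (forall x : R, 0 < x -> is_derive x 1 (fun x => (-1) ^+ k * f x) (- G x)) ->
  0 < x -> is_derive x 1 f (- ((-1) ^+ k * G x)).
Proof.
move=> df x0; have dx := df x x0.
rewrite [f](_ : _ = fun y => (-1) ^+ k * ((-1) ^+ k * f y)); last first.
  by apply/funext => y; rewrite signrMK.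
by apply: is_derive_eq; rewrite /GRing.scale/= mulrN.
Qed.

Lemma completely_monotoneP F :
  completely_monotone F <-> forall n, cm_upto n F.
Proof.
split=> [cmF n|].
  suff H k : cm_upto n (fun x => (-1) ^+ k * derive1n k F x).
    by apply: eq_cm_upto (H 0%N) => x _; rewrite expr0 mul1r.
  elim: n k => [|n IHn] k; first by split=> // x x0; have [] := cmF k x x0.
  split=> [x x0|]; first by have [] := cmF k x x0.
  exists (fun x => (-1) ^+ k.+1 * derive1n k.+1 F x) => // x x0.
  have [/derivableP dk _] := cmF k x x0.
  apply: is_derive_eq.
  by rewrite derive1nS derive1E /GRing.scale/= exprS mulN1r mulNr opprK.
move=> cmF.
have cmk k n : cm_upto n (fun x => (-1) ^+ k * derive1n k F x) /\
    forall x, 0 < x -> derivable (derive1n k F) x 1.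
  suff {n}cmk : forall n, cm_upto n (fun x => (-1) ^+ k * derive1n k F x).
    split=> // x x0; have [_ [G dk _]] := cmk 1%N.
    by have [+ _] := derive_sign dk x0.
  elim: k => [|k IHk] n.
    by apply: eq_cm_upto (cmF n) => x _; rewrite mul1r.
  have [G dk cmG] := cm_neg_derive IHk.
  apply: eq_cm_upto (cmG n) => x x0.
  rewrite derive1nS derive1E; have [_ ->] := derive_sign dk x0.
  by rewrite exprS mulN1r mulNr mulrN opprK signrMK.
move=> k x x0; have [cmk0 dk] := cmk k 0%N.
by split; [exact: dk|exact: cm_upto_ge0 cmk0 x x0].
Qed.

End complete_monotonicity.

(** * Laplace transforms on the half-line *)

Section bounded_factor.
Context {d} {T : measurableType d} {R : realType}.
Variable mu : {measure set T -> \bar R}.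

Lemma integrable_boundedM (D : set T) (f h : T -> R) (C : R) : measurable D ->
  mu.-integrable D (EFin \o f) -> measurable_fun D h ->
  (forall t, D t -> `|h t| <= C) ->
  mu.-integrable D (EFin \o (fun t => h t * f t)).
Proof.
move=> mD intf mh hC.
have mf : measurable_fun D f.
  by apply/measurable_EFinP; exact: measurable_int intf.
apply: (le_integrable mD _ _ (integrableZl mD C intf)).
- by apply/measurable_EFinP; exact: measurable_funM.
- move=> t Dt.
  rewrite lee_fin !normrM ler_wpM2r//.
  by rewrite (le_trans (hC _ Dt))// ler_norm.
Qed.

End bounded_factor.

Section laplace.
Context {R : realType}.
Implicit Types (f h : R -> R).
Notation mu := (@lebesgue_measure R).
Notation half_line := (`[0%R, +oo[%classic : set R).

(** Stated on [measurableTypeR R], the carrier of [lebesgue_measure]. *)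
Lemma measurable_half_line : measurable (half_line : set (measurableTypeR R)).
Proof. exact: measurable_itv. Qed.

(** The [n]-th derivative of the Laplace transform of [f], up to the sign
    [(-1) ^+ n]. *)
Definition exp_moment f (n : nat) (x : R) : R :=
  \int[mu]_(t in half_line) (t ^+ n * expR (- (x * t)) * f t).

Lemma measurable_exprn_exp n (x : R) :
  measurable_fun half_line (fun t : R => t ^+ n * expR (- (x * t))).
Proof.
apply: measurable_funM; first exact: exprn_measurable.
apply: measurableT_comp; first exact: measurable_expR.
rewrite [X in measurable_fun _ X](_ : _ = *%R (- x)); last first.
  by apply/funext => t; rewrite mulNr.
exact: mulrl_measurable.
Qed.

(** The bound is uniform in [y >= x]: it provides the dominating function when
    differentiating under the integral sign at any point above [x]. *)
Lemma exprn_exp_bounded n (x : R) : 0 < x ->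
  exists C, forall y t : R, x <= y -> 0 <= t ->
    `|t ^+ n * expR (- (y * t))| <= C.
Proof.
move=> x0; exists (n`!%:R / x ^+ n) => y t xy t0.
have yt0 : 0 <= y * t by rewrite mulr_ge0// (le_trans (ltW x0)).
rewrite ger0_norm ?mulr_ge0 ?exprn_ge0 ?expR_ge0//.
rewrite expRN ler_pdivrMr ?expR_gt0//.
rewrite mulrAC ler_pdivlMr ?exprn_gt0//.
apply: (@le_trans _ _ (n`!%:R * expR (x * t))); last first.
  by rewrite ler_wpM2l// ler_expR ler_wpM2r.
rewrite -exprMn [x * t]mulrC.
have xt0 : 0 <= t * x by rewrite mulr_ge0// ltW.
case: n => [|n]; first by rewrite expr0 fact0 mul1r -expR0 ler_expR.
rewrite -ler_pdivrMl ?ltr0n ?fact_gt0//.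
by rewrite [leLHS]mulrC; apply: le_trans (expR_ge1Dxn n xt0); rewrite lerDr.
Qed.

Section moments.
Variable f : R -> R.
Hypothesis intf : mu.-integrable half_line (EFin \o f).

Lemma integrable_exp_moment n (x : R) : 0 < x ->
  mu.-integrable half_line
    (EFin \o (fun t => t ^+ n * expR (- (x * t)) * f t)).
Proof.
move=> x0; have [C HC] := exprn_exp_bounded n x0.
apply: (@integrable_boundedM _ _ _ _ _ _ _ C) => //.
  exact: measurable_exprn_exp.
by move=> t /=; rewrite in_itv/= andbT => t0; exact: HC.
Qed.

Lemma is_derive_exp_moment n (x : R) : 0 < x ->
  is_derive x 1 (exp_moment f n) (- exp_moment f n.+1 x).
Proof.
move=> x0.
have x20 : 0 < x / 2 by rewrite divr_gt0.
have [C HC] := exprn_exp_bounded n.+1 x20.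
pose F (y t : R) := t ^+ n * expR (- (y * t)) * f t.
have dF (y t : R) :
    is_derive y 1 (F ^~ t) (- (t ^+ n.+1 * expR (- (y * t)) * f t)).
  by apply: is_derive_eq; rewrite /GRing.scale/= exprSr; ring.
have dFE (y t : R) : partial1of2 F y t = - (t ^+ n.+1 * expR (- (y * t)) * f t).
  by rewrite partial1of2E; have [_ ->] := dF y t.
have xI : (`]x / 2, x + 1[%classic : set R) x.
  by rewrite /= in_itv/= ltrDl ltr01 andbT; lra.
have intF y : (`]x / 2, x + 1[%classic : set R) y ->
    mu.-integrable half_line (EFin \o F y).
  rewrite /= in_itv/= => /andP[xy _].
  by apply: integrable_exp_moment; exact: lt_trans xy.
have dF1 (y t : R) : (`]x / 2, x + 1[%classic : set R) y -> half_line t ->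
    derivable (F ^~ t) y 1.
  by move=> _ _; have [] := dF y t.
have G0 (t : R) : 0 <= `|C| * `|f t| by exact: mulr_ge0.
have intG : mu.-integrable half_line (EFin \o (fun t => `|C| * `|f t|)).
  apply: (@integrable_boundedM _ _ _ _ _ _ _ `|C|) => //.
  - exact: (integrable_abse intf).
  - by move=> t _; rewrite normr_id.
have GF (y t : R) : (`]x / 2, x + 1[%classic : set R) y -> half_line t ->
    `|partial1of2 F y t| <= `|C| * `|f t|.
  rewrite /= !in_itv/= andbT => /andP[xy _] t0.
  rewrite dFE normrN normrM ler_wpM2r// (le_trans _ (ler_norm _))//.
  by apply: HC => //; exact: ltW.
have mD := measurable_half_line.
have dx := derivable_under_integral mD xI intF dF1 G0 intG GF.
have := differentiation_under_integral mD xI intF dF1 G0 intG GF.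
rewrite derive1E => Dx; apply: DeriveDef => //.
rewrite [LHS]Dx /exp_moment -[RHS]mulN1r -RintegralZl//; last first.
  exact: integrable_exp_moment.
by apply: eq_Rintegral => t _; rewrite dFE mulN1r.
Qed.

Lemma cm_upto_exp_moment n k : (forall t, 0 <= t -> 0 <= f t) ->
  cm_upto n (exp_moment f k).
Proof.
move=> f0.
have m0 m x : 0 <= exp_moment f m x.
  apply: Rintegral_ge0 => t; rewrite /= in_itv/= andbT => t0.
  by rewrite !mulr_ge0 ?exprn_ge0 ?expR_ge0 ?f0.
elim: n k => [|n IHn] k; first by split.
split=> //; exists (exp_moment f k.+1) => // x x0.
exact: is_derive_exp_moment.
Qed.

(** By uniqueness of derivatives, the signed derivatives of [F] are the
    successive moments. *)
Lemma exp_moment_ge0 n k F : cm_upto n F ->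
  (forall x, 0 < x -> F x = exp_moment f k x) ->
  forall x, 0 < x -> 0 <= exp_moment f (n + k) x.
Proof.
elim: n k F => [|n IHn] k F Fn Fk x x0.
  by rewrite add0n -Fk// (cm_upto_ge0 Fn).
have [_ [G dF Gn]] := Fn.
rewrite addSnnS; apply: IHn Gn _ x x0 => x x0.
apply: oppr_inj; have [_ <-] := dF x x0.
apply: derive_val; apply: near_eq_is_derive (is_derive_exp_moment k x0).
by apply: near_gt0_eq x0 _ => y y0; rewrite Fk.
Qed.

End moments.
End laplace.

(** * Bernstein's theorem for a continuous integrable density *)

Section laplace_positivity.
Context {R : realType}.
Implicit Types (f : R -> R).
Notation mu := (@lebesgue_measure R).
Notation half_line := (`[0%R, +oo[%classic : set R).

(** Normalised to reach its maximum 1 at [t = t0], so that the powers of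
    [bump t0] concentrate there; they are positive multiples of the functions
    integrated in [exp_moment]. *)
Definition bump (t0 t : R) : R := t / t0 * expR (1 - t / t0).

Lemma bumpX n (t0 t : R) : 0 < t0 ->
  bump t0 t ^+ n = (expR 1 / t0) ^+ n * (t ^+ n * expR (- (n%:R / t0 * t))).
Proof.
move=> t00; rewrite /bump expRB !exprMn.
have -> : n%:R / t0 * t = n%:R * (t / t0) by rewrite mulrA mulrAC.
rewrite expRN expRM_natl !exprVn; ring.
Qed.

Lemma bump_ge0 (t0 t : R) : 0 < t0 -> 0 <= t -> 0 <= bump t0 t.
Proof.
by move=> t00 t1; rewrite mulr_ge0 ?expR_ge0// divr_ge0// ltW.
Qed.

(** With u = t / t0, the square of [(1 + u) / 2 <= expR ((u - 1) / 2)] bounds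
    [expR (u - 1)] below by [((1 + u) / 2) ^+ 2], which exceeds [u] by
    [((u - 1) / 2) ^+ 2]. *)
Lemma bump_le (t0 t e : R) : 0 < t0 -> 0 <= t -> 0 <= e ->
  e * t0 <= `|t - t0| -> bump t0 t <= 1 - (e / (2 + e)) ^+ 2.
Proof.
move=> t00 t1 e0; set u := t / t0.
have u0 : 0 <= u by rewrite divr_ge0// ltW.
have -> : t - t0 = (u - 1) * t0 by rewrite mulrBl mul1r divfK// gt_eqF.
rewrite normrM (gtr0_norm t00) ler_pM2r// => eu.
have E0 : 0 < (1 + u) / 2 by lra.
have ? : (1 + u) / 2 <= expR ((u - 1) / 2).
  by apply: le_trans (expR_ge1Dx _); lra.
have E : ((1 + u) / 2) ^+ 2 <= expR (u - 1).
  have -> : u - 1 = 2%:R * ((u - 1) / 2) by field.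
  rewrite expRM_natl ler_pXn2r// ?nnegrE ?expR_ge0//; exact: ltW.
rewrite /bump -/u -opprB expRN ler_pdivrMr ?expR_gt0//.
have k0 : 0 <= 1 - (e / (2 + e)) ^+ 2.
  rewrite subr_ge0 expr_le1// ?divr_ge0//; last lra.
  by rewrite ler_pdivrMr; lra.
apply: le_trans (ler_wpM2l k0 E).
have q0 : 0 <= e / (2 + e) * ((1 + u) / 2).
  by rewrite mulr_ge0 ?divr_ge0//; lra.
have qu : e / (2 + e) * ((1 + u) / 2) <= `|(u - 1) / 2|.
  rewrite normrM [`|2^-1|]gtr0_norm ?invr_gt0// mulrA ler_pM2r ?invr_gt0//.
  rewrite mulrAC ler_pdivrMr; last lra.
  by have [u1|u1] := leP 0 (u - 1);
    [rewrite (ger0_norm u1) in eu *|rewrite (ltr0_norm u1) in eu *]; nra.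
have : (e / (2 + e) * ((1 + u) / 2)) ^+ 2 <= ((u - 1) / 2) ^+ 2.
  by rewrite -[leRHS]real_normK ?num_real// ler_pXn2r// nnegrE.
have : u = ((1 + u) / 2) ^+ 2 - ((u - 1) / 2) ^+ 2 by field.
rewrite [(e / (2 + e) * _) ^+ 2]exprMn.
set X := ((1 + u) / 2) ^+ 2; set Z := ((u - 1) / 2) ^+ 2.
set Q := (e / (2 + e)) ^+ 2 => hu hq.
have -> : (1 - Q) * X = X - Q * X by ring.
lra.
Qed.

Lemma continuous_bump (t0 : R) : continuous (bump t0).
Proof.
move=> t; apply: differentiable_continuous; apply/derivable1_diffP.
have [] // : is_derive t 1 (bump t0)
    (t0^-1 * expR (1 - t / t0) - t / t0 * (expR (1 - t / t0) / t0)).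
by apply: is_derive_eq; rewrite /GRing.scale/=; ring.
Qed.

Lemma continuous_ball f (t0 b c : R) : {for t0, continuous f} ->
  0 < b -> 0 < c -> exists2 d : R, 0 < d < b &
    forall t, `|t - t0| <= d -> `|f t - f t0| <= c.
Proof.
move=> /cvgrPdist_le cf b0 /cf /nbhs_ballP[e /= e0 eP].
exists (Num.min (e / 2) (b / 2)).
  by rewrite lt_min gt_min; apply/andP; split; [|apply/orP; right]; lra.
move=> t; rewrite le_min => /andP[te _]; rewrite distrC; apply: eP.
by rewrite /ball/= distrC; lra.
Qed.

(** Laplace's method.  If [f < 0] near [t0], the part of the integral of
    [bump t0 t ^+ n * f t] near [t0] is at most a negative multiple of
    [theta' ^+ n], whereas the part far from [t0] is at most a multiple of
    [theta ^+ n] for some [theta < theta'], a contradiction for large [n]. *)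
Lemma ge0_of_exp_moment f (t0 : R) :
  mu.-integrable half_line (EFin \o f) ->
  (forall n (x : R), 0 < x -> 0 <= exp_moment f n x) ->
  0 < t0 -> {for t0, continuous f} -> 0 <= f t0.
Proof.
move=> intf mom0 t00 cf; rewrite leNgt; apply/negP => ft0.
pose eta := - f t0 / 2.
have eta0 : 0 < eta by rewrite /eta; lra.
have [d d0 dP] : exists2 d : R, 0 < d < t0 &
    forall t, `|t - t0| <= d -> f t <= - eta.
  have [d d0 dP] := continuous_ball cf t00 eta0; exists d => // t /dP.
  by rewrite ler_norml => /andP[_]; rewrite /eta; lra.
case/andP: d0 => d0 dt0.
(* [theta] bounds [bump t0] outside [[t0 - d, t0 + d]], by [bump_le] *)
pose q := (d / t0) / (2 + d / t0).
pose theta := 1 - q ^+ 2.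
have q01 : 0 < q < 1.
  have : 0 < d / t0 by rewrite divr_gt0.
  rewrite /q; set e := d / t0 => e0; apply/andP; split.
    by rewrite divr_gt0//; lra.
  by rewrite ltr_pdivrMr; lra.
have theta01 : 0 < theta < 1 by rewrite /theta; nra.
case/andP: theta01 => theta0 theta1.
pose theta' := (1 + theta) / 2.
have [d' d'0 d'P] : exists2 d' : R, 0 < d' <= d &
    forall t, `|t - t0| <= d' -> theta' <= bump t0 t.
  have t1 : 0 < (1 - theta) / 2 by lra.
  have [d' /andP[d0' d1'] dP'] :=
    continuous_ball (@continuous_bump t0 t0) d0 t1.
  exists d'; first by rewrite d0' ltW.
  move=> t /dP'; rewrite /bump divff ?gt_eqF// subrr expR0 mulr1 ler_norml.
  by move=> /andP[+ _]; rewrite /theta'; lra.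
case/andP: d'0 => d'0 d'd.
pose I := \int[mu]_(t in half_line) `|f t|.
have th'0 : 0 < theta' by rewrite /theta'; lra.
suff H n : (0 < n)%N -> eta * (2 * d') <= (theta / theta') ^+ n * I.
  have r1 : `|theta / theta'| < 1.
    rewrite ger0_norm; last by rewrite divr_ge0// ltW.
    by rewrite ltr_pdivrMr// /theta'; lra.
  have /cvgrPdist_lt cv : (theta / theta') ^+ n * I @[n --> \oo] --> 0 * I.
    by apply: cvgM; [exact: cvg_expr|exact: cvg_cst].
  have p0 : 0 < eta * (2 * d') by apply: mulr_gt0 => //; lra.
  have [N _ /(_ N.+1 (leqnSn N))] := cv _ p0.
  rewrite mul0r sub0r normrN ltNge => /negP; apply.
  by apply: le_trans (H N.+1 isT) (ler_norm _).
move=> n0.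
pose A := (`[t0 - d', t0 + d']%classic : set R).
have AD : A `<=` half_line.
  move=> t; rewrite /A /= !in_itv/= andbT => /andP[+ _]; lra.
have pw t : half_line t ->
    bump t0 t ^+ n * f t <= theta ^+ n * `|f t| - eta * theta' ^+ n * \1_A t.
  rewrite /= in_itv/= andbT => t1.
  have b0 := bump_ge0 t00 t1.
  have [tA|tA] := boolP (t \in A).
    rewrite indicE tA mulr1.
    have td' : `|t - t0| <= d'.
      by move: tA; rewrite inE /A/= in_itv/= ler_norml; lra.
    have := dP _ (le_trans td' d'd); have := d'P _ td' => b1 ft.
    have : theta' ^+ n <= bump t0 t ^+ n.
      by rewrite lerXn2r// ?nnegrE// ltW.
    have : 0 <= theta ^+ n * `|f t| by rewrite mulr_ge0// exprn_ge0// ltW.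
    have : 0 <= theta' ^+ n by rewrite exprn_ge0// ltW.
    nra.
  rewrite indicE (negPf tA) mulr0 subr0.
  have [td|td] := leP `|t - t0| d.
    have ft := dP _ td; apply: (@le_trans _ _ 0).
      by rewrite mulr_ge0_le0// ?exprn_ge0//; lra.
    by rewrite mulr_ge0// exprn_ge0// ltW.
  have bt : bump t0 t <= theta.
    apply: bump_le => //; first by rewrite divr_ge0// ltW.
    by rewrite divfK ?gt_eqF// ltW.
  apply: (@le_trans _ _ (bump t0 t ^+ n * `|f t|)).
    by rewrite ler_wpM2l ?exprn_ge0// ler_norm.
  by rewrite ler_wpM2r// lerXn2r// ?nnegrE// ltW.
have mD := @measurable_half_line R.
have intn : mu.-integrable half_line (EFin \o (fun t => `|f t|)).
  exact: (integrable_abse intf).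
have mA : measurable (A : set (measurableTypeR R)) by exact: measurable_itv.
have muA : mu A = (2 * d')%:E.
  rewrite /A lebesgue_measure_itv/= lte_fin ifT; last lra.
  by rewrite -EFinB; congr (_%:E); ring.
have IA : (\int[mu]_(t in half_line) (\1_A t)%:E = (2 * d')%:E)%E.
  by rewrite integral_indic// setIidl.
have intA : mu.-integrable half_line (EFin \o (\1_A : R -> R)).
  apply/integrableP; split.
    by apply/measurable_EFinP; exact: measurable_indic.
  under eq_integral do rewrite /= ger0_norm//.
  by rewrite IA ltry.
have intb : mu.-integrable half_line (EFin \o (fun t => bump t0 t ^+ n * f t)).
  apply: (@integrable_boundedM _ _ _ _ _ _ _ 1) => //.
    apply: measurable_funX; apply: measurable_funTS.
    exact: continuous_measurable_fun (@continuous_bump t0).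
  move=> t; rewrite /= in_itv/= andbT => t1.
  have b0 := bump_ge0 t00 t1.
  have b1 : bump t0 t <= 1.
    have := bump_le t00 t1 (lexx 0); rewrite !mul0r expr0n/= subr0; exact.
  by rewrite ger0_norm ?exprn_ge0// exprn_ile1.
have intr1 : mu.-integrable half_line (EFin \o (fun t => theta ^+ n * `|f t|)).
  exact: (integrableZl mD (theta ^+ n) intn).
have intr2 : mu.-integrable half_line
    (EFin \o (fun t => eta * theta' ^+ n * (\1_A t : R))).
  exact: (integrableZl mD (eta * theta' ^+ n) intA).
have intr : mu.-integrable half_line (EFin \o
    (fun t => theta ^+ n * `|f t| - eta * theta' ^+ n * (\1_A t : R))).
  exact: (integrableB mD intr1 intr2).
have := le_Rintegral mD intb intr pw.
rewrite RintegralB// !RintegralZl// -/I.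
have -> : \int[mu]_(t in half_line) (\1_A t : R) = 2 * d'.
  by rewrite /Rintegral IA.
have -> : \int[mu]_(t in half_line) (bump t0 t ^+ n * f t) =
    (expR 1 / t0) ^+ n * exp_moment f n (n%:R / t0).
  rewrite /exp_moment -RintegralZl//; last first.
    by apply: integrable_exp_moment; rewrite // divr_gt0// ltr0n.
  by apply: eq_Rintegral => t _; rewrite bumpX// !mulrA.
have : 0 <= (expR 1 / t0) ^+ n * exp_moment f n (n%:R / t0).
  rewrite mulr_ge0 ?exprn_ge0 ?divr_ge0 ?expR_ge0 ?(ltW t00)//.
  by apply: mom0; rewrite divr_gt0// ltr0n.
move=> le0 /(le_trans le0); rewrite subr_ge0 => le1.
rewrite expr_div_n [leRHS]mulrAC ler_pdivlMr ?exprn_gt0//.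
by apply: le_trans le1; rewrite le_eqVlt; apply/orP; left; apply/eqP; ring.
Qed.

Lemma bernstein_half_line f F :
  mu.-integrable half_line (EFin \o f) -> {within half_line, continuous f} ->
  (forall x, 0 < x -> F x = exp_moment f 0 x) ->
  completely_monotone F <-> (forall t, 0 <= t -> 0 <= f t).
Proof.
move=> intf cf FE; split => [/completely_monotoneP cmF|f0]; last first.
  apply/completely_monotoneP => n.
  by apply: eq_cm_upto (cm_upto_exp_moment intf n 0 f0) => x x0; rewrite FE.
have mom0 n x : 0 < x -> 0 <= exp_moment f n x.
  by move=> x0; rewrite -[n]addn0; apply: (exp_moment_ge0 intf (cmF n)).
move/continuous_within_itvcyP : cf => [cf0 cf1].
have fpos t : 0 < t -> 0 <= f t.
  move=> t0; apply: ge0_of_exp_moment => //.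
  by apply: cf0; rewrite in_itv/= t0.
move=> t; rewrite le_eqVlt => /predU1P[<-|]; last exact: fpos.
apply: (cvgr_to_ge cf1).
near=> s; apply: fpos.
by near: s; exact: nbhs_right_gt.
Unshelve. all: by end_near. Qed.

End laplace_positivity.

(** * Polynomial approximation of a step *)

Section step_approximation.
Context {R : realType}.
Implicit Types (a v : R).

Lemma bernoulli_le a N : 0 <= a -> 1 + N%:R * a <= (1 + a) ^+ N.
Proof.
move=> a0; elim: N => [|N IHN]; first by rewrite mul0r addr0 expr0.
rewrite exprS -natr1; have : 0 <= N%:R * a by rewrite mulr_ge0.
by nra.
Qed.

Lemma bernoulli_ge a N : 0 <= a <= 1 -> 1 - N%:R * a <= (1 - a) ^+ N.
Proof.
move=> a01; elim: N => [|N IHN]; first by rewrite mul0r subr0 expr0.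
rewrite exprS -natr1; have : 0 <= N%:R * a by rewrite mulr_ge0//; lra.
have : (1 - a) * (1 - N%:R * a) <= (1 - a) * (1 - a) ^+ N.
  by rewrite ler_wpM2l//; lra.
by nra.
Qed.

Lemma exprB1_le_inv a N : 0 <= a <= 1 -> (1 - a) ^+ N <= (1 + N%:R * a)^-1.
Proof.
move=> a01; have N0 : 0 <= N%:R * a by rewrite mulr_ge0//; lra.
rewrite -[leRHS]mul1r ler_pdivlMr; last lra.
apply: (@le_trans _ _ ((1 - a) ^+ N * (1 + a) ^+ N)).
  by rewrite ler_wpM2l ?bernoulli_le ?exprn_ge0//; lra.
by rewrite -exprMn exprn_ile1//; nra.
Qed.

(** The polynomials of Brosowski and Deutsch, which separate u < n^-2 from
    u > n^-2 inside [[0, 1]]. *)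
Definition soft_step (n : nat) (u : R) : R := (1 - u ^+ n) ^+ ((n ^ 2) ^ n).

Lemma soft_step_itv n u : 0 <= u <= 1 -> 0 <= soft_step n u <= 1.
Proof.
move=> /andP[u0 u1]; have un0 := exprn_ge0 n u0; have un1 := exprn_ile1 n u0 u1.
by rewrite exprn_ge0 ?exprn_ile1//; lra.
Qed.

Lemma natrXX n : ((n ^ 2) ^ n)%:R = (n%:R ^+ 2) ^+ n :> R.
Proof. by rewrite !natrX. Qed.

(** Put a = (u n)^n and K = (n^2)^n, so that K a = (n^2 u n)^n behaves like
    l^n.  If l < 1, Bernoulli's inequality gives (1 - a)^K >= 1 - K a, which
    tends to 1; if l > 1, then (1 - a)^K <= 1 / (1 + K a), which tends to 0. *)
Lemma cvg_soft_step (u : nat -> R) (l : R) : (forall n, 0 <= u n <= 1) ->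
  (n%:R ^+ 2 * u n) @[n --> \oo] --> l -> l != 1 ->
  soft_step n (u n) @[n --> \oo] --> ((l < 1)%R%:R : R).
Proof.
move=> u01 ul l1.
have un01 n : 0 <= u n ^+ n <= 1.
  by have /andP[u0 u1] := u01 n; rewrite exprn_ge0 ?exprn_ile1.
have Nu n : ((n ^ 2) ^ n)%:R * u n ^+ n = (n%:R ^+ 2 * u n) ^+ n.
  by rewrite natrXX -exprMn.
have v0 n : 0 <= n%:R ^+ 2 * u n.
  by have /andP[u0 u1] := u01 n; rewrite mulr_ge0// exprn_ge0.
have l0 : 0 <= l by apply: (cvgr_to_ge ul); exact: nearW.
have [ll1|ll1] := ltP l 1.
  pose th := (1 + l) / 2.
  have th0 : 0 <= th by rewrite /th; lra.
  have th1 : th < 1 by rewrite /th; lra.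
  apply: (@squeeze_cvgr _ _ _ _ (fun n => 1 - th ^+ n) (fun=> 1)).
  - near=> n; have /andP[_ ->] := soft_step_itv n (u01 n); rewrite andbT.
    apply: le_trans (bernoulli_ge _ (un01 n)).
    rewrite lerB// Nu lerXn2r ?nnegrE//.
    by near: n; apply: (cvgr_le _ ul); rewrite /th; lra.
  - rewrite -[X in _ --> X]subr0; apply: cvgB; first exact: cvg_cst.
    by apply: cvg_expr; rewrite ger0_norm.
  - exact: cvg_cst.
pose th := (1 + l) / 2.
have {}ll1 : 1 < l by rewrite lt_neqAle eq_sym l1.
have th1 : 1 < th by rewrite /th; lra.
apply: (@squeeze_cvgr _ _ _ _ (fun=> 0) (fun n => th^-1 ^+ n)).
- near=> n; have /andP[-> _] := soft_step_itv n (u01 n); rewrite /=.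
  apply: le_trans (exprB1_le_inv _ (un01 n)) _.
  have thn : th ^+ n <= (n%:R ^+ 2 * u n) ^+ n.
    rewrite lerXn2r ?nnegrE//; first lra.
    by near: n; apply: (cvgr_ge _ ul); rewrite /th; lra.
  have thp : 0 < th ^+ n by rewrite exprn_gt0//; lra.
  by rewrite exprVn lef_pV2 ?posrE// Nu; lra.
- exact: cvg_cst.
- apply: cvg_expr; rewrite ger0_norm ?invr_ge0; last lra.
  by rewrite invf_lt1; lra.
Unshelve. all: by end_near. Qed.

(** The derivative of the sine at 0 along the sequence [x / n%:R]. *)
Lemma cvg_natr_sin (x : R) : (n%:R * sin (x / n%:R)) @[n --> \oo] --> x.
Proof.
have [->|x0] := eqVneq x 0.
  by under eq_fun do rewrite mul0r sin0 mulr0; exact: cvg_cst.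
have [/cvg_ex[/= l dl] D] := is_derive_sin (0 : R).
have l1 : l = 1.
  by move: D; rewrite /derive (cvg_lim _ dl)// cos0.
have xn0 : (forall n, x / n.+1%:R != 0) /\ (x / n.+1%:R) @[n --> \oo] --> 0.
  split=> [n|]; first by rewrite mulf_neq0 ?invr_eq0.
  rewrite -(mulr0 x); apply: cvgM; first exact: cvg_cst.
  exact: cvg_harmonic.
move: dl => /cvgr_dnbhsP/(_ _ xn0).
rewrite l1 => H.
rewrite -cvg_shiftS/=.
have : x * (sin (x / n.+1%:R) / (x / n.+1%:R)) @[n --> \oo] --> x * 1.
  apply: cvgM; first exact: cvg_cst.
  move: H; under eq_fun do
    rewrite scaler1 addr0 sin0 subr0 /GRing.scale/= mulrC.
  exact.
rewrite mulr1; apply: cvg_trans; apply: near_eq_cvg; near=> n.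
have : n.+1%:R != 0 :> R by rewrite pnatr_eq0.
by move: (n.+1%:R : R) => m m0; field; rewrite x0 m0.
Unshelve. all: by end_near. Qed.

End step_approximation.

(** * Uniqueness of the cosine transform *)

Section cosine_uniqueness.
Context {R : realType}.
Notation mu := (@lebesgue_measure R).
Notation half_line := (`[0%R, +oo[%classic : set R).
Variable k : R -> R.
Hypothesis intk : mu.-integrable half_line (EFin \o k).
Hypothesis cosk :
  forall y : R, \int[mu]_(t in half_line) (cos (y * t) * k t) = 0.

Let mD := @measurable_half_line R.

Lemma continuous_horner_cos (p : {poly R}) (w : R) :
  continuous (fun t : R => p.[cos (w * t)]).
Proof.
move=> t; apply: continuous_comp; last exact: continuous_horner.
apply: continuous_comp; last exact: continuous_cos.
by apply: mulrl_continuous.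
Qed.

Lemma horner_cos_bounded (p : {poly R}) :
  exists C, forall x : R, `|p.[cos x]| <= C.
Proof.
elim/poly_ind: p => [|p c [C HC]].
  by exists 0 => x; rewrite horner0 normr0.
exists (C + `|c|) => x.
rewrite hornerMXaddC (le_trans (ler_normD _ _))// lerD2r.
rewrite normrM -[leRHS]mulr1 ler_pM//.
by rewrite ler_norml cos_le1 cos_geN1.
Qed.

Lemma integrable_horner_cosM (p : {poly R}) (w y : R) :
  mu.-integrable half_line
    (EFin \o (fun t => p.[cos (w * t)] * cos (y * t) * k t)).
Proof.
have [C HC] := horner_cos_bounded p.
apply: (@integrable_boundedM _ _ _ _ _ _ _ C) => //.
  apply: measurable_funTS; apply: measurable_funM.
    exact: continuous_measurable_fun (@continuous_horner_cos _ _).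
  have := @continuous_horner_cos 'X y.
  by under eq_fun do rewrite hornerX; exact: continuous_measurable_fun.
move=> t _; rewrite normrM -[leRHS]mulr1 ler_pM//.
by rewrite ler_norml cos_le1 cos_geN1.
Qed.

(** The factor [cos (y * t)] with arbitrary [y] makes the induction go through:
    a product of two cosines is the half-sum of the cosines of the sum and of
    the difference of the angles. *)
Lemma Rintegral_horner_cosM (p : {poly R}) (w y : R) :
  \int[mu]_(t in half_line) (p.[cos (w * t)] * cos (y * t) * k t) = 0.
Proof.
elim/poly_ind: p y => [|p c IHp] y.
  under eq_Rintegral do rewrite horner0 !mul0r.
  by rewrite Rintegral_cst// mul0r.
have I z := integrable_horner_cosM p w z.
have E t : (p * 'X + c%:P).[cos (w * t)] * cos (y * t) * k t =
    2^-1 * (p.[cos (w * t)] * cos ((y + w) * t) * k t) +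
    2^-1 * (p.[cos (w * t)] * cos ((y - w) * t) * k t) +
    c * ((1 : {poly R}).[cos (w * t)] * cos (y * t) * k t).
  have -> : (y + w) * t = y * t + w * t by ring.
  have -> : (y - w) * t = y * t - w * t by ring.
  by rewrite hornerMXaddC cosD cosB hornerC; field.
under eq_Rintegral do rewrite E.
have I1 : mu.-integrable half_line (EFin \o
    (fun t => 2^-1 * (p.[cos (w * t)] * cos ((y + w) * t) * k t))).
  exact: (integrableZl mD _ (I (y + w))).
have I2 : mu.-integrable half_line (EFin \o
    (fun t => 2^-1 * (p.[cos (w * t)] * cos ((y - w) * t) * k t))).
  exact: (integrableZl mD _ (I (y - w))).
have I3 := integrable_horner_cosM 1 w y.
rewrite RintegralD//; last 2 first.
- exact: (integrableD mD I1 I2).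
- exact: (integrableZl mD _ I3).
rewrite RintegralD// !RintegralZl// !IHp !mulr0 !add0r.
under eq_Rintegral do rewrite hornerC mul1r.
by rewrite cosk mulr0.
Qed.

(** The argument of [soft_step] is sin(t / (T n))^2.  Multiplied by n^2 it tends
    to (t / T)^2, so that these bounded functions converge to the indicator of
    [t < T], the periodic copies of the step being pushed to infinity. *)
Definition cos_step (T : R) (n : nat) (t : R) : R :=
  soft_step n ((1 - cos (2 / (T * n%:R) * t)) / 2).

Lemma cos_stepE T n : exists p : {poly R}, forall t : R,
  cos_step T n t = p.[cos (2 / (T * n%:R) * t)] * cos (0 * t).
Proof.
exists ((1 - (2^-1 *: (1 - 'X)) ^+ n) ^+ ((n ^ 2) ^ n)) => t.
by rewrite mul0r cos0 mulr1 !hornerE /cos_step /soft_step mulrC.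
Qed.

Lemma integrable_cos_step T n :
  mu.-integrable half_line (EFin \o (fun t => cos_step T n t * k t)).
Proof.
have [p pE] := cos_stepE T n.
rewrite [X in _ \o X](_ : _ = fun t =>
  p.[cos (2 / (T * n%:R) * t)] * cos (0 * t) * k t); last first.
  by apply/funext => t; rewrite pE.
exact: integrable_horner_cosM.
Qed.

Lemma Rintegral_cos_step T n :
  \int[mu]_(t in half_line) (cos_step T n t * k t) = 0.
Proof.
have [p pE] := cos_stepE T n.
rewrite -[RHS](Rintegral_horner_cosM p (2 / (T * n%:R)) 0).
by apply: eq_Rintegral => t _; rewrite pE.
Qed.

(** Dominated convergence along [cos_step T]. *)
Lemma Rintegral_itv0_eq0 (T : R) : 0 < T -> \int[mu]_(t in `[0, T]) k t = 0.
Proof.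
move=> T0; have TD : `[0, T]%classic `<=` half_line.
  by move=> t; rewrite /= !in_itv/= andbT => /andP[].
have u01 n (t : R) : 0 <= (1 - cos (2 / (T * n%:R) * t)) / 2 <= 1.
  have := cos_le1 (2 / (T * n%:R) * t).
  by have := cos_geN1 (2 / (T * n%:R) * t); lra.
have cvg_step t : t != T -> 0 <= t ->
    cos_step T n t @[n --> \oo] --> ((t < T)%R%:R : R).
  move=> tT t0.
  have -> : (t < T)%R = ((t / T) ^+ 2 < 1).
    by rewrite expr_lt1// ?ltr_pdivrMr ?mul1r// divr_ge0// ltW.
  apply: cvg_soft_step => [n||]; [exact: u01| |].
    have c1 := @cvg_natr_sin R (t / T).
    have cc := cvgM c1 c1; rewrite expr2.
    apply: cvg_trans (cc _); apply: near_eq_cvg; apply: nearW => n /=.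
    have -> : 2 / (T * n%:R) * t = (t / T / n%:R) *+ 2.
      by rewrite invfM -mulr_natr; ring.
    by rewrite cos_mulr2n cos2sin2 -mulr_natr; field.
  rewrite pexpr_eq1 ?divr_ge0// ?(ltW T0)//.
  by apply: contra tT => /eqP/divr1_eq ->.
pose A := (`[0, T]%classic : set R).
have mA : measurable (A : set (measurableTypeR R)) by exact: measurable_itv.
have mk : measurable_fun half_line k.
  by apply/measurable_EFinP; exact: measurable_int intk.
have aecvg : {ae mu, forall t, half_line t ->
    (cos_step T n t * k t)%:E @[n --> \oo] --> (\1_A t * k t)%:E}.
  exists [set T]; split; [exact: measurable_set1|exact: lebesgue_measure_set1|].
  move=> t /= H; apply: contrapT => tT; apply: H.
  rewrite in_itv/= andbT => t0.
  apply: cvg_EFin; first exact: nearW.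
  apply: cvgM; last exact: cvg_cst.
  suff -> : \1_A t = (t < T)%R%:R :> R by apply: cvg_step => //; exact/eqP.
  rewrite indicE; congr ((nat_of_bool _)%:R); apply/idP/idP.
    by rewrite inE /A/= in_itv/= t0/= lt_neqAle => ->; rewrite andbT; exact/eqP.
  by move=> tT'; rewrite inE /A/= in_itv/= t0 ltW.
have intn : mu.-integrable half_line (EFin \o (fun t => `|k t|)).
  exact: (integrable_abse intk).
have dom : {ae mu, forall t n, half_line t ->
    (`|(cos_step T n t * k t)%:E| <= `|k t|%:E)%E}.
  apply: aeW => t n t0; rewrite lee_fin normrM ler_piMl//.
  by have /andP[a b] := soft_step_itv n (u01 n t); rewrite ger0_norm.
have mf_ n : measurable_fun half_line (fun t => (cos_step T n t * k t)%:E).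
  exact: measurable_int (integrable_cos_step T n).
have mf : measurable_fun half_line (fun t => (\1_A t * k t)%:E).
  apply/measurable_EFinP.
  by apply: measurable_funM => //; exact: measurable_indic.
have [_ _ ] := dominated_convergence mD mf_ mf aecvg intn dom.
have -> : [sequence \int[mu]_(t in half_line) (cos_step T n t * k t)%:E]_n%E =
    (fun=> 0%E).
  apply/funext => n /=.
  rewrite -[LHS]fineK; last exact: integrable_fin_num (integrable_cos_step T n).
  by rewrite [X in X%:E]Rintegral_cos_step.
move=> /cvg_lim; rewrite lim_cst// => /(_ (@ereal_hausdorff _)) E.
rewrite /Rintegral.
suff -> : (\int[mu]_(t in `[0%R, T]) (k t)%:E =
  \int[mu]_(t in half_line) (\1_A t * k t)%:E)%E by rewrite -E.
rewrite -[in LHS](setIidr TD) integral_mkcondr; apply: eq_integral => t _.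
by rewrite /patch indicE -/A; case: ifP => _; rewrite ?mul1r ?mul0r.
Qed.

(** The primitive of [k] vanishes, hence so does its derivative [k]. *)
Lemma eq0_of_cosine_transform : {within half_line, continuous k} ->
  forall t, 0 <= t -> k t = 0.
Proof.
move/continuous_within_itvcyP => [ck k0].
have kt0 t : 0 < t -> k t = 0.
  move=> t0; have tt1 : t < t + 1 by rewrite ltrDl.
  have intk1 : mu.-integrable `[0, t + 1] (EFin \o k).
    apply: integrableS intk => //; last exact: subset_itvl.
  have ckt : {for t, continuous k} by apply: ck; rewrite in_itv/= t0.
  have [_ <-] := continuous_FTC1_closed tt1 intk1 t0 ckt.
  rewrite derive1E; apply: derive_val.
  have d0 : is_derive t 1 (fun _ : R => 0 : R) 0 by exact: is_derive_cst.
  apply: near_eq_is_derive d0.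
  by apply: (near_gt0_eq t0) => y y0; rewrite Rintegral_itv0_eq0.
move=> t; rewrite le_eqVlt => /predU1P[<-|]; last exact: kt0.
apply: (cvg_unique _ k0) => //; apply: cvg_near_cst.
near=> s; apply: kt0.
by near: s; exact: nbhs_right_gt.
Unshelve. all: by end_near. Qed.

End cosine_uniqueness.

(** * Exponential generating functions *)

Section exponential_generating_function.
Context {R : realType}.
Implicit Types (h : nat -> R) (t : R).

Definition egf h t : R := limn (pseries (fun k => h k / k`!%:R) t).

Definition geom_bounded h := exists C M : R, forall k, `|h k| <= C * M ^+ k.

Definition shift h (i : nat) : nat -> R := fun k => h (k + i)%N.

Lemma geom_bounded_shift h i : geom_bounded h -> geom_bounded (shift h i).
Proof.
move=> [C [M hCM]]; exists (C * M ^+ i), M => k.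
by rewrite -mulrA -exprD addnC; exact: hCM.
Qed.

Lemma is_cvg_egf h t : geom_bounded h ->
  cvgn (pseries (fun k => h k / k`!%:R) t).
Proof.
move=> [C [M hCM]].
apply: normed_cvg.
pose B := `|M| * `|t|.
have cB : cvgn (series (fun k => `|C| * exp_coeff B k)).
  apply: is_cvg_seriesZ; exact: is_cvg_series_exp_coeff.
apply: series_le_cvg cB => k /=; first exact: normr_ge0.
  by rewrite mulr_ge0// exp_coeff_ge0// mulr_ge0.
rewrite /= /exp_coeff /= !normrM normfV normrX normr_nat /B exprMn.
have hk : `|h k| <= `|C| * `|M| ^+ k.
  by rewrite (le_trans (hCM k))// -normrX -normrM ler_norm.
have := ler_wpM2r (_ : 0 <= k`!%:R^-1 * `|t| ^+ k) hk.
rewrite mulr_ge0 ?invr_ge0 ?exprn_ge0// => /(_ isT).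
rewrite (mulrA `|h k|) => /le_trans; apply.
by rewrite le_eqVlt; apply/orP; left; apply/eqP; ring.
Qed.

Lemma pseries_diffs_egf h :
  pseries_diffs (fun k => h k / k`!%:R) = (fun k => shift h 1 k / k`!%:R).
Proof.
apply/funext => k; rewrite /pseries_diffs /shift addn1 factS natrM.
have k1 : k.+1%:R != 0 :> R by rewrite pnatr_eq0.
have k2 : k`!%:R != 0 :> R by rewrite pnatr_eq0 -lt0n fact_gt0.
by move: (k.+1%:R : R) k1 => m m0; field; rewrite m0 k2.
Qed.

(** Differentiating an exponential generating function shifts its
    coefficients. *)
Lemma is_derive_egf h t : geom_bounded h ->
  is_derive t 1 (egf h) (egf (shift h 1) t).
Proof.
move=> bh.
have b1 := geom_bounded_shift 1 bh; have b2 := geom_bounded_shift 1 b1.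
rewrite /egf -pseries_diffs_egf.
apply: (@pseries_snd_diffs _ _ (`|t| + 1)).
- exact: is_cvg_egf.
- by rewrite pseries_diffs_egf; exact: is_cvg_egf.
- by rewrite !pseries_diffs_egf; exact: is_cvg_egf.
- by rewrite [ltRHS]ger0_norm ?addr_ge0// ltrDl.
Qed.

Lemma egf0 h : egf h 0 = h 0%N.
Proof.
apply/cvg_lim => //.
rewrite -cvg_shiftS; apply: cvg_near_cst; apply: nearW => n.
rewrite /pseries /series /= big_nat_recl//= expr0 mulr1 fact0 divr1.
rewrite big1 ?addr0//.
by move=> i _; rewrite expr0n mulr0.
Qed.

End exponential_generating_function.

(** * The impulse response of a monic polynomial *)

Section impulse_response.
Context {R : realType}.
Implicit Types (P Q : {poly R}) (h : nat -> R).

(** The coefficients, up to an index shift, of the expansion of 1 / P in powers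
    of 1/z.  The initial values are 0, ..., 0, 1; there are none when [P] is
    constant, and the recurrence then forces [h = 0]. *)
Record impulse_response P h : Prop := ImpulseResponse {
  impulse_rec : forall k, \sum_(j < size P) P`_j * h (k + j)%N = 0;
  impulse_init :
    forall j, (j < (size P).-1)%N -> h j = (j.+1 == (size P).-1)%:R }.

Lemma impulse_bounded P h : P \is monic -> impulse_response P h ->
  geom_bounded h.
Proof.
move=> mP [rec init].
have sP : size P = (size P).-1.+1 by rewrite prednK// size_poly_gt0 monic_neq0.
move: rec init; move: (size P).-1 sP => n sP rec init.
pose M := 1 + \sum_(j < n) `|P`_j|.
have M1 : 1 <= M by rewrite lerDl sumr_ge0.
have M0 : 0 <= M by exact: le_trans M1.
exists 1, M => k; rewrite mul1r; elim/ltn_ind: k => k IHk.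
have [kn|nk] := ltnP k n.
  rewrite init//; case: (_ == _); first by rewrite normr1 exprn_ege1.
  by rewrite normr0 exprn_ge0.
have := rec (k - n)%N; rewrite sP big_ord_recr/= subnK//.
have -> : P`_n = 1 by have /monicP := mP; rewrite lead_coefE sP.
rewrite mul1r => /eqP; rewrite addrC addr_eq0 => /eqP ->.
rewrite normrN (le_trans (ler_norm_sum _ _ _))//.
have [k0|k0] := posnP k.
  have n0 : n = 0%N by move: nk; rewrite k0 leqn0 => /eqP.
  by rewrite k0; clear -n0; subst n; rewrite big_ord0.
apply: (@le_trans _ _ (\sum_(j < n) `|P`_j| * M ^+ k.-1)).
  apply: ler_sum => j _; rewrite normrM ler_wpM2l//.
  have jk : (k - n + j < k)%N by have := ltn_ord j; lia.
  apply: le_trans (IHk _ jk) _; apply: ler_weXn2l => //; lia.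
rewrite -mulr_suml -[in leRHS](prednK k0) exprS ler_wpM2r ?exprn_ge0//.
by rewrite /M lerDr.
Qed.

End impulse_response.

(** * The companion matrix *)

Section companion.
Context {R : realType}.
Variable P : {poly R}.
Hypothesis mP : P \is monic.
Notation n := (size P).-1.
Hypothesis n0 : (0 < n)%N.

Let A : 'M[R]_n := companionmx P.
Let e : 'cV[R]_n := \col_i (i == n.-1 :> nat)%:R.
Let i0 : 'I_n := Ordinal n0.
Let v k : 'cV[R]_n := A ^+ k *m e.

Let vS k i : v k.+1 i 0 = \sum_j A i j * v k j 0.
Proof. by rewrite /v exprS -mulmxA mxE. Qed.

Let AE i j : A i j = if i == n.-1 :> nat then - P`_j else (i.+1 == j :> nat)%:R.
Proof. by rewrite mxE. Qed.

Definition companion_impulse k : R := v k i0 0.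

(** The superdiagonal of ones moves each entry of [A ^+ k *m e] up by one row at
    the next power, so that the whole vector is read off its first entry. *)
Lemma companion_impulse_shift k (j : 'I_n) :
  v k j 0 = companion_impulse (k + j).
Proof.
case: j => j; elim: j k => [|j IHj] k jn.
  by rewrite addn0 /companion_impulse; congr (v k _ 0); exact: val_inj.
have jn' : (j < n)%N by exact: ltnW.
have jn1 : (j == n.-1) = false by rewrite ltn_eqF// -ltnS (prednK n0).
rewrite addnS -addSn -(IHj k.+1 jn') vS (bigD1 (Ordinal jn))//= big1 => [|l lj].
  by rewrite AE /= jn1 eqxx mul1r addr0.
rewrite AE /= jn1 (_ : (j.+1 == l) = false) ?mul0r//.
by apply: contraNF lj => /eqP jl; apply/eqP/val_inj; rewrite /= -jl.
Qed.

Lemma companion_impulse_response : impulse_response P companion_impulse.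
Proof.
have sP : size P = n.+1 by rewrite prednK// size_poly_gt0 monic_neq0.
split=> [k|j jn].
  rewrite sP big_ord_recr/=.
  have -> : P`_n = 1 by have /monicP := mP; rewrite lead_coefE sP.
  have nl : (n.-1 < n)%N by rewrite prednK.
  have -> : (k + n)%N = (k.+1 + (Ordinal nl : 'I_n))%N.
    by rewrite /= addSn -addnS prednK.
  rewrite -companion_impulse_shift vS mul1r -big_split/= big1// => j _.
  by rewrite AE /= eqxx companion_impulse_shift mulNr subrr.
rewrite -(add0n j) -(companion_impulse_shift 0 (Ordinal jn)).
rewrite /v expr0 mul1mx mxE/=.
by congr (nat_of_bool _)%:R; rewrite -[in RHS](prednK n0) eqSS.
Qed.

Lemma exprZmx (t : R) k : (t *: A) ^+ k = t ^+ k *: A ^+ k.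
Proof.
elim: k => [|k IHk]; first by rewrite !expr0 scale1r.
by rewrite !exprS IHk -[LHS]/(_ *m _) -scalemxAl -scalemxAr scalerA.
Qed.

(** Only the last column of the exponential matters, and its entries are the
    exponential generating functions of the shifted impulse response. *)
Lemma carma_kernelE (Q : {poly R}) (t : R) : carma_kernel P Q t =
  \sum_(j < n) Q`_j * egf (shift companion_impulse j) t.
Proof.
rewrite /carma_kernel -mulmxA mxE; apply: eq_bigr => j _.
rewrite mxE; congr (_ * _).
have nl : (n.-1 < n)%N by rewrite prednK.
rewrite mxE (bigD1 (Ordinal nl))//= big1 ?addr0 => [|l ln].
  rewrite !mxE/= eqxx mulr1 /egf; congr (limn (series _)); apply/funext => k.
  rewrite -/A exprZmx mxE /shift/= -companion_impulse_shift /v mxE.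
  rewrite (bigD1 (Ordinal nl))//= big1 ?addr0 => [|l ln].
    by rewrite mxE /= eqxx mulr1 mulrAC [RHS]mulrAC; ring.
  rewrite mxE (_ : (l == n.-1 :> nat) = false) ?mulr0//.
  by apply: contraNF ln => /eqP l1; apply/eqP/val_inj; rewrite /= l1.
rewrite !mxE (_ : (l == n.-1 :> nat) = false) ?mulr0//.
by apply: contraNF ln => /eqP l1; apply/eqP/val_inj; rewrite /= l1.
Qed.

End companion.

(** * Differential operators applied to the impulse response *)

Section differential_operators.
Context {R : realType}.
Variables (P : {poly R}) (h : nat -> R).
Implicit Types (q r : {poly R[i]}) (t : R).
Hypothesis mP : P \is monic.
Hypothesis hP : impulse_response P h.
Notation n := (size P).-1.
Notation PC := (map_poly (real_complex R) P).

Let bh : geom_bounded h := impulse_bounded mP hP.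

(** The [i]-th derivative of the function [egf h]. *)
Definition dimpulse (i : nat) (t : R) : R := egf (shift h i) t.

Lemma is_derive_dimpulse i (t : R) :
  is_derive t 1 (dimpulse i) (dimpulse i.+1 t).
Proof.
have := is_derive_egf t (geom_bounded_shift i bh).
have -> // : shift (shift h i) 1 = shift h i.+1.
by apply/funext => k; rewrite /shift -addnA add1n.
Qed.

(** The function q(D) phi, where phi is [egf h] and D is differentiation. *)
Definition diffop (q : {poly R[i]}) (t : R) : R[i] :=
  \sum_(i < size q) q`_i * (dimpulse i t)%:C.

Lemma diffop_widen m q t : (size q <= m)%N ->
  diffop q t = \sum_(i < m) q`_i * (dimpulse i t)%:C.
Proof.
move=> qm; rewrite /diffop.
rewrite (big_ord_widen m (fun i => q`_i * (dimpulse i t)%:C))//.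
rewrite big_mkcond/=; apply: eq_bigr => i _; case: ltnP => // qi.
by rewrite nth_default// mul0r.
Qed.

Lemma diffopD q r t : diffop (q + r) t = diffop q t + diffop r t.
Proof.
have qm := leq_maxl (size q) (size r); have rm := leq_maxr (size q) (size r).
rewrite (diffop_widen _ (size_polyD q r)).
rewrite (diffop_widen _ qm) (diffop_widen _ rm).
by rewrite -big_split; apply: eq_bigr => i _ /=; rewrite coefD mulrDl.
Qed.

Lemma diffopZ (c : R[i]) q t : diffop (c *: q) t = c * diffop q t.
Proof.
rewrite (diffop_widen _ (size_scale_leq c q)) /diffop mulr_sumr.
by apply: eq_bigr => i _; rewrite coefZ mulrA.
Qed.

Lemma diffopMX q t :
  diffop (q * 'X) t = \sum_(i < size q) q`_i * (dimpulse i.+1 t)%:C.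
Proof.
have qX : (size (q * 'X)%R <= (size q).+1)%N.
  by rewrite (leq_trans (size_polyMleq _ _))// size_polyX addn2.
rewrite (diffop_widen _ qX).
rewrite big_ord_recl coefMX/= mul0r add0r.
by apply: eq_bigr => i _; rewrite coefMX.
Qed.

Lemma Re_sum (I : finType) (F : I -> R[i]) :
  complex.Re (\sum_i F i) = \sum_i complex.Re (F i).
Proof. by elim/big_rec2: _ => // i a b _ <-; case: (F i) b => ? ? []. Qed.

Lemma Im_sum (I : finType) (F : I -> R[i]) :
  complex.Im (\sum_i F i) = \sum_i complex.Im (F i).
Proof. by elim/big_rec2: _ => // i a b _ <-; case: (F i) b => ? ? []. Qed.

Lemma Re_mulrC (z : R[i]) (x : R) : complex.Re (z * x%:C) = complex.Re z * x.
Proof. by case: z => a b /=; rewrite mulr0 subr0. Qed.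

Lemma Im_mulrC (z : R[i]) (x : R) : complex.Im (z * x%:C) = complex.Im z * x.
Proof. by case: z => a b /=; rewrite mulr0 add0r. Qed.

Lemma is_derive_lincomb m (c : 'I_m -> R) (t : R) :
  is_derive t 1 (fun t : R => \sum_(i < m) c i * dimpulse i t)
    (\sum_(i < m) c i * dimpulse i.+1 t).
Proof.
elim: m c => [|m IHm] c.
  under eq_fun do rewrite big_ord0; rewrite big_ord0; exact: is_derive_cst.
under eq_fun do rewrite big_ord_recr/=; rewrite big_ord_recr/=.
have := IHm (fun i => c (widen_ord (leqnSn m) i)) => /= H1.
have H2 := is_derive_dimpulse m t.
by apply: is_derive_eq.
Qed.

Lemma is_derive_Re_diffop q (t : R) :
  is_derive t 1 (fun t : R => complex.Re (diffop q t))
    (complex.Re (diffop (q * 'X) t)).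
Proof.
rewrite diffopMX Re_sum; under eq_bigr do rewrite Re_mulrC.
rewrite /diffop; under eq_fun do rewrite Re_sum.
under eq_fun do under eq_bigr do rewrite Re_mulrC.
exact: is_derive_lincomb.
Qed.

Lemma is_derive_Im_diffop q (t : R) :
  is_derive t 1 (fun t : R => complex.Im (diffop q t))
    (complex.Im (diffop (q * 'X) t)).
Proof.
rewrite diffopMX Im_sum; under eq_bigr do rewrite Im_mulrC.
rewrite /diffop; under eq_fun do rewrite Im_sum.
under eq_fun do under eq_bigr do rewrite Im_mulrC.
exact: is_derive_lincomb.
Qed.

Lemma dimpulse_rec t : \sum_(i < size P) P`_i * dimpulse i t = 0.
Proof.
have cv i : pseries (fun k => shift h i k / k`!%:R) t @ \oo --> dimpulse i t.
  exact: is_cvg_egf (geom_bounded_shift i bh).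
have : \sum_(i < size P)
      P`_i * pseries (fun k => shift h i k / k`!%:R) t m @[m --> \oo] -->
    \sum_(i < size P) P`_i * dimpulse i t.
  elim: (size P) => [|m IHm].
    by under eq_fun do rewrite big_ord0; rewrite big_ord0; exact: cvg_cst.
  under eq_fun do rewrite big_ord_recr/=; rewrite big_ord_recr/=.
  by apply: cvgD IHm _; apply: cvgM; [exact: cvg_cst|exact: cv].
move=> /cvg_unique; apply; first exact: norm_hausdorff.
apply: cvg_near_cst; apply: nearW => m.
rewrite /pseries /series/=; under eq_bigr do rewrite mulr_sumr.
rewrite exchange_big/= big1// => k _.
transitivity ((\sum_(i < size P) P`_i * h (k + i)%N) * (k`!%:R^-1 * t ^+ k)).
  by rewrite mulr_suml; apply: eq_bigr => i _; rewrite /shift !mulrA.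
by rewrite (impulse_rec hP) mul0r.
Qed.

(** P(D) phi = 0 by the recurrence, and the factor X added by each induction
    step differentiates a function that is identically zero. *)
Lemma diffop_annihilate q t : diffop (PC * q) t = 0.
Proof.
elim/poly_ind: q t => [|q c IHq] t.
  by rewrite mulr0 /diffop size_poly0 big_ord0.
rewrite mulrDr diffopD mulrA [PC * c%:P]mulrC mul_polyC diffopZ.
have -> : diffop PC t = 0.
  rewrite /diffop size_map_poly.
  rewrite -[RHS]/((0 : R)%:C) -(dimpulse_rec t) rmorph_sum/=.
  by apply: eq_bigr => i _; rewrite coef_map rmorphM.
rewrite mulr0 addr0.
apply/eqP; rewrite eq_complex /=.
have [_ <-] := is_derive_Re_diffop (PC * q) t.
have [_ <-] := is_derive_Im_diffop (PC * q) t.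
by apply/andP; split; apply/eqP; under [in LHS]eq_fun do rewrite IHq;
  exact: derive_cst.
Qed.

(** The initial values of phi single out one coefficient; when [P] is constant,
    [q = 0] and both sides vanish. *)
Lemma diffop0 q : (size q <= n)%N -> diffop q 0 = q`_n.-1.
Proof.
move=> qn; rewrite (diffop_widen _ qn).
have hE i : (i < n)%N -> dimpulse i 0 = (i.+1 == n)%:R.
  by move=> iN; rewrite /dimpulse egf0 /shift add0n (impulse_init hP).
have [n0|n0] := posnP n.
  rewrite n0 big_ord0; move: qn; rewrite n0 leqn0 size_poly_eq0 => /eqP->.
  by rewrite coef0.
have nl : (n.-1 < n)%N by rewrite prednK.
rewrite (bigD1 (Ordinal nl))//= big1 => [|i il].
  by rewrite hE// prednK// eqxx mulr1 addr0.
rewrite hE// (_ : (i.+1 == n) = false) ?mulr0//.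
by apply: contraNF il => /eqP iN; apply/eqP/val_inj/(congr1 predn iN).
Qed.

End differential_operators.

(** * Exponential decay for stable polynomials *)

Section exponential_decay.
Context {R : realType}.

Definition exp_decay (a : R -> R) : Prop := exists C e : R,
  0 < e /\ forall t, 0 <= t -> a t <= C * expR (- (e * t)).

Lemma nonincreasing_of_derive (m m' : R -> R) (t : R) :
  (forall s : R, is_derive s 1 m (m' s)) -> (forall s, 0 <= s -> m' s <= 0) ->
  0 <= t -> m t <= m 0.
Proof.
move=> dm m'0 t0.
have cm : {within `[0, t], continuous m}.
  by apply: derivable_within_continuous => s _; have [] := dm s.
have [c] := MVT_segment t0 (fun s _ => dm s) cm.
rewrite in_itv/= => /andP[c0 _] E.
by rewrite -subr_le0 E subr0 mulr_le0_ge0// m'0.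
Qed.

(** Gronwall's argument, with a rate at most that of [v] and less than [- x]. *)
Lemma exp_decay_energy (u u' v : R -> R) (x : R) : x < 0 ->
  (forall t : R, is_derive t 1 u (u' t)) -> (forall t, 0 <= t -> 0 <= u t) ->
  (forall t, 0 <= t -> u' t <= x * u t + v t) -> exp_decay v -> exp_decay u.
Proof.
move=> x0 du u0 u'le [C [e [e0 vC]]].
pose d := Num.min e (- x / 2).
have d0 : 0 < d by rewrite lt_min e0/=; lra.
have dx : 0 < - x - d.
  have : d <= - x / 2 by rewrite ge_min lexx orbT.
  lra.
have {}vC t : 0 <= t -> v t <= `|C| * expR (- (d * t)).
  move=> t0; rewrite (le_trans (vC t t0))//.
  apply: (@le_trans _ _ (`|C| * expR (- (e * t)))).
    by rewrite ler_wpM2r ?expR_ge0// ler_norm.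
  by rewrite ler_wpM2l// ler_expR lerN2 ler_wpM2r// ge_min lexx.
pose K := `|C| / (- x - d).
have K0 : 0 <= K by rewrite divr_ge0// ltW.
exists (u 0 + K), d; split=> // t t0.
pose m (s : R) := expR (- (x * s)) * u s - K * expR ((- x - d) * s).
pose m' (s : R) :=
  expR (- (x * s)) * (u' s - x * u s - `|C| * expR (- (d * s))).
have dm (s : R) : is_derive s 1 m (m' s).
  have dus := du s.
  apply: is_derive_eq; rewrite /GRing.scale/= /m'.
  have -> : (- x - d) * s = - (x * s) + - (d * s) by ring.
  rewrite expRD /K; field; lra.
have m'0 s : 0 <= s -> m' s <= 0.
  move=> s0; rewrite mulr_ge0_le0 ?expR_ge0//.
  by have := u'le s s0; have := vC s s0; lra.
have := nonincreasing_of_derive dm m'0 t0.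
rewrite /m !mulr0 oppr0 expR0 mul1r mulr1 => mt.
have : expR (x * t) * (expR (- (x * t)) * u t - K * expR ((- x - d) * t)) <=
    expR (x * t) * u 0.
  by rewrite ler_wpM2l ?expR_ge0//; lra.
rewrite mulrBr mulrA expRxMexpNx_1 mul1r mulrCA -expRD.
have -> : x * t + (- x - d) * t = - (d * t) by ring.
have : expR (x * t) * u 0 <= expR (- (d * t)) * u 0.
  rewrite ler_wpM2r ?u0// ler_expR -mulNr ler_wpM2r//; lra.
lra.
Qed.

(** The pair a + i b solves u' = (x + i y) u + (v + i w).  Its energy |u|^2
    satisfies the hypothesis of [exp_decay_energy], the cross terms
    2 (a v + b w) being at most - x |u|^2 + |v + i w|^2 / (- x). *)
Lemma exp_decay_first_order (a b v w : R -> R) (x y : R) : x < 0 ->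
  (forall t : R, is_derive t 1 a (x * a t - y * b t + v t)) ->
  (forall t : R, is_derive t 1 b (x * b t + y * a t + w t)) ->
  exp_decay (fun t => v t ^+ 2 + w t ^+ 2) ->
  exp_decay (fun t => a t ^+ 2 + b t ^+ 2).
Proof.
move=> x0 da db [C [e [e0 HC]]].
apply: (@exp_decay_energy _
  (fun t => 2 * a t * (x * a t - y * b t + v t) +
    2 * b t * (x * b t + y * a t + w t))
  (fun t => (v t ^+ 2 + w t ^+ 2) / - x) x) => //.
- move=> t; have dat := da t; have dbt := db t.
  have -> : (fun s => a s ^+ 2 + b s ^+ 2) =
      (fun s => a s * a s + b s * b s).
    by apply/funext => s; rewrite !expr2.
  by apply: is_derive_eq; rewrite /GRing.scale/=; ring.
- by move=> t _; rewrite addr_ge0 ?sqr_ge0.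
- move=> t _; rewrite -subr_ge0.
  set A := a t; set B := b t; set V := v t; set W := w t.
  have -> : x * (A ^+ 2 + B ^+ 2) + (V ^+ 2 + W ^+ 2) / - x -
    (2 * A * (x * A - y * B + V) + 2 * B * (x * B + y * A + W)) =
    ((x * A + V) ^+ 2 + (x * B + W) ^+ 2) / - x by field; lra.
  by rewrite divr_ge0 ?addr_ge0 ?sqr_ge0//; lra.
- exists (C / - x), e; split=> // t t0; rewrite mulrAC ler_pM2r ?HC//.
  by rewrite invr_gt0; lra.
Qed.

End exponential_decay.

Section stable_polynomial.
Context {R : realType}.
Variables (P : {poly R}) (h : nat -> R).
Implicit Types (q : {poly R[i]}) (t : R).
Hypothesis mP : P \is monic.
Hypothesis hP : impulse_response P h.
Hypothesis stableP : no_zero_in_Cplus P.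
Notation n := (size P).-1.
Notation PC := (map_poly (real_complex R) P).
Notation diffop := (diffop h).

Definition sqnorm (z : R[i]) : R := complex.Re z ^+ 2 + complex.Im z ^+ 2.

Lemma exp_decay_peel (z : R[i]) q : complex.Re z < 0 ->
  exp_decay (sqnorm \o diffop (('X - z%:P) * q)) ->
  exp_decay (sqnorm \o diffop q).
Proof.
case: z => x y /= x0 decq.
have E t : diffop (q * 'X) t =
    (x +i* y) * diffop q t + diffop (('X - (x +i* y)%:P) * q) t.
  by rewrite -diffopZ -diffopD mulrBl mul_polyC addrC subrK mulrC.
apply: (exp_decay_first_order (y := y) x0 _ _ decq) => t.
- have := is_derive_Re_diffop mP hP q t; rewrite E.
  by case: (diffop q t) => a b; case: (diffop _ t).
- have := is_derive_Im_diffop mP hP q t; rewrite E.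
  by case: (diffop q t) => a b; case: (diffop _ t).
Qed.

(** Starting from P(D) q(D) phi = 0, the linear factors of [P] are removed one
    at a time by [exp_decay_peel]. *)
Lemma diffop_exp_decay q : exp_decay (sqnorm \o diffop q).
Proof.
have [rs] := closed_field_poly_normal PC.
rewrite (_ : lead_coef PC = 1) ?scale1r; last first.
  by rewrite lead_coef_map (monicP mP) rmorph1.
move=> PE.
have rs0 z : z \in rs -> complex.Re z < 0.
  move=> zrs; rewrite ltNge; apply/negP => /stableP/negP; apply.
  by rewrite -[_ == _]/(root PC z) PE root_prod_XsubC.
have := diffop_annihilate mP hP q; rewrite PE {PE}.
elim: rs q rs0 => [|z rs IHrs] q rs0 ann.
  have q0 t : diffop q t = 0.
    by have := ann t; rewrite big_nil -{2}[q]mul1r => <-.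
  by exists 0, 1; split=> // t _; rewrite /sqnorm /= q0 /= !expr0n addr0 mul0r.
apply: (@exp_decay_peel z); first by apply: rs0; rewrite mem_head.
apply: IHrs => [y yrs|t]; first by apply: rs0; rewrite inE yrs orbT.
by have := ann t; rewrite big_cons mulrA [_ * ('X - _)]mulrC.
Qed.

End stable_polynomial.

(** * The transform of the impulse response *)

Section decaying_integrands.
Context {R : realType}.
Notation mu := (@lebesgue_measure R).
Notation half_line := (`[0%R, +oo[%classic : set R).

Lemma cvgy_expRN (e : R) : 0 < e -> expR (- (e * t)) @[t --> +oo] --> 0.
Proof.
move=> e0.
apply: (@cvg_comp _ _ _ (fun t => e * t) (fun s => expR (- s)) _
  (pinfty_nbhs R)).
  exact: gt0_cvgMry.
exact: cvgr_expR.
Qed.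

Lemma sqr_le_expRN (a C e t : R) : a ^+ 2 <= C * expR (- (e * t)) ->
  `|a| <= (1 + `|C|) * expR (- (e / 2 * t)).
Proof.
move=> aC; have B0 : 0 <= (1 + `|C|) * expR (- (e / 2 * t)).
  by rewrite mulr_ge0 ?expR_ge0// addr_ge0.
rewrite -ler_sqr ?nnegrE//.
rewrite real_normK ?num_real// (le_trans aC)// exprMn.
rewrite -expRM_natl (_ : 2%:R * - (e / 2 * t) = - (e * t)); last by field.
rewrite ler_wpM2r ?expR_ge0// (le_trans (ler_norm C))//.
have := normr_ge0 C; nra.
Qed.

Lemma ge0_integral_antiderivative (u U : R -> R) : continuous u ->
  (forall t, 0 <= t -> 0 <= u t) -> (forall t : R, is_derive t 1 U (- u t)) ->
  U t @[t --> +oo] --> 0 ->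
  mu.-integrable half_line (EFin \o u) /\
  (\int[mu]_(t in half_line) (u t)%:E = (U 0)%:E)%E.
Proof.
move=> cu u0 dU U0.
have dN (t : R) : is_derive t 1 (- U) (u t).
  by have := dU t => d1; apply: is_derive_eq; rewrite opprK.
have IE : (\int[mu]_(t in half_line) (u t)%:E = (U 0)%:E)%E.
  rewrite (@ge0_continuous_FTC2y _ u (- U) 0 0)//.
  - by rewrite -EFinB sub0r opprK.
  - exact: continuous_subspaceT.
  - by rewrite -oppr0; exact: cvgN.
  - apply: cvg_at_right_filter; apply: differentiable_continuous.
    by apply/derivable1_diffP; have [] := dN 0.
  - by move=> t _; rewrite derive1E; have [_ ->] := dN t.
split=> //; apply/integrableP; split.
  apply/measurable_EFinP; apply: measurable_funTS.
  exact: continuous_measurable_fun.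
rewrite (_ : (\int[mu]_(t in half_line) _ =
  \int[mu]_(t in half_line) (u t)%:E)%E).
  by rewrite IE ltry.
apply: eq_integral => t.
by rewrite inE /= in_itv/= andbT => t0; rewrite ger0_norm ?u0.
Qed.

(** Adding an exponential that dominates [F] reduces the claim to non-negative
    integrands. *)
Lemma integral_antiderivative (F W : R -> R) (B e : R) : 0 < e ->
  continuous F -> (forall t, 0 <= t -> `|F t| <= B * expR (- (e * t))) ->
  (forall t : R, is_derive t 1 W (- F t)) -> W t @[t --> +oo] --> 0 ->
  mu.-integrable half_line (EFin \o F) /\ \int[mu]_(t in half_line) F t = W 0.
Proof.
move=> e0 cF FB dW W0.
have mD := @measurable_half_line R.
pose E (t : R) := B * expR (- (e * t)).
pose E' (t : R) := B / e * expR (- (e * t)).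
have dE (t : R) : is_derive t 1 E' (- E t).
  by apply: is_derive_eq; rewrite /GRing.scale/= /E; field; rewrite gt_eqF.
have dE2 (t : R) : is_derive t 1 E (- e * E t).
  by apply: is_derive_eq; rewrite /GRing.scale/= /E; ring.
have cE : continuous E.
  move=> t; apply: differentiable_continuous.
  by apply/derivable1_diffP; have [] := dE2 t.
have E'0 : E' t @[t --> +oo] --> 0.
  by rewrite -(mulr0 (B / e)); apply: cvgM; [exact: cvg_cst|exact: cvgy_expRN].
have E0 t : 0 <= t -> 0 <= E t by move=> t0; exact: le_trans (FB t t0).
have [iE IE] := ge0_integral_antiderivative cE E0 dE E'0.
have cEF : continuous (fun t => E t + F t).
  by move=> t; apply: cvgD; [exact: cE|exact: cF].
have EF0 t : 0 <= t -> 0 <= E t + F t.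
  by move=> /FB; rewrite ler_norml -/(E t) => /andP[+ _]; lra.
have dEF (t : R) : is_derive t 1 (fun t => E' t + W t) (- (E t + F t)).
  by have := dE t; have := dW t => d1 d2; apply: is_derive_eq; rewrite opprD.
have EW0 : (E' t + W t) @[t --> +oo] --> 0.
  by rewrite -(addr0 0); exact: cvgD.
have [iEF IEF] := ge0_integral_antiderivative cEF EF0 dEF EW0.
have FE : F = fun t => (E t + F t) - E t.
  by apply/funext => t; rewrite addrAC subrr add0r.
split.
  have := integrableB mD iEF iE; apply: eq_integrable => // t _ /=.
  by rewrite -EFinB addrAC subrr add0r.
rewrite FE RintegralB// /Rintegral IEF IE /=; ring.
Qed.

End decaying_integrands.

Section rational_transform.
Context {R : realType}.

(** The real function N(D) phi. *)
Definition rational_kernel (h : nat -> R) (N : {poly R}) (t : R) : R :=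
  \sum_(i < size N) N`_i * dimpulse h i t.

Variables (P : {poly R}) (h : nat -> R).
Implicit Types (q : {poly R[i]}) (t : R).
Hypothesis mP : P \is monic.
Hypothesis hP : impulse_response P h.
Hypothesis stableP : no_zero_in_Cplus P.
Notation mu := (@lebesgue_measure R).
Notation half_line := (`[0%R, +oo[%classic : set R).
Notation n := (size P).-1.
Notation toC := (map_poly (real_complex R)).
Notation diffop := (diffop h).
Variable N : {poly R}.
Hypothesis sizeN : (size N <= n)%N.

Lemma diffop_real t : diffop (toC N) t = (rational_kernel h N t)%:C.
Proof.
rewrite /diffop size_map_poly rmorph_sum/=.
by apply: eq_bigr => i _; rewrite coef_map rmorphM.
Qed.

Lemma continuous_rational_kernel : continuous (rational_kernel h N).
Proof.
move=> t; apply: differentiable_continuous; apply/derivable1_diffP.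
by have [] := is_derive_lincomb mP hP (fun i : 'I_(size N) => N`_i) t.
Qed.

(** The numerator vanishes at [z], whence the quotient [K].  Its coefficient of
    degree [n.-1] is that of degree [n] of the numerator, namely N(z)/P(z) as
    [P] is monic of degree [n], and [diffop0] reads it off at time 0. *)
Lemma partial_fraction_quotient (z : R[i]) : 0 <= complex.Re z ->
  exists2 K : {poly R[i]},
    (ceval N z / ceval P z) *: toC P - toC N = K * ('X - z%:P) &
    diffop K 0 = ceval N z / ceval P z.
Proof.
move=> z0; set c := _ / _.
have [K KE] : exists K, c *: toC P - toC N = K * ('X - z%:P).
  apply/factor_theorem; rewrite /root hornerD hornerN hornerZ /c divfK ?subrr//.
  exact: stableP.
exists K => //.
have sP : size P = n.+1 by rewrite prednK// size_poly_gt0 monic_neq0.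
have sK : (size K <= n)%N.
  have [->|K0] := eqVneq K 0; first by rewrite size_poly0.
  rewrite -ltnS -sP.
  have <- : size (K * ('X - z%:P)) = (size K).+1.
    by rewrite size_Mmonic ?monicXsubC// size_XsubC addn2.
  rewrite -KE (leq_trans (size_polyD _ _))// geq_max size_polyN size_map_poly.
  rewrite (leq_trans (size_scale_leq _ _)) ?size_map_poly//=.
  by rewrite (leq_trans sizeN)// leq_pred.
rewrite (diffop0 hP sK).
have [n0|n0] := posnP n.
  move: sK; rewrite n0 leqn0 size_poly_eq0 => /eqP->; rewrite coef0.
  move: sizeN; rewrite n0 leqn0 size_poly_eq0 => /eqP N0.
  by rewrite /c N0 /ceval map_poly0 horner0 mul0r.
have : (c *: toC P - toC N)`_n = (K * ('X - z%:P))`_n by rewrite KE.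
rewrite coefB coefZ !coef_map/= (nth_default _ sizeN) rmorph0 subr0.
have -> : P`_n = 1 by have /monicP := mP; rewrite lead_coefE.
rewrite rmorph1 mulr1 => ->.
rewrite mulrBr coefB coefMC coefMX (nth_default _ sK).
by rewrite mul0r subr0 eqn0Ngt n0.
Qed.

(** The real part of the Laplace transform at z = x + i y.  With [K] as in
    [partial_fraction_quotient], (D - z) K(D) phi = - N(D) phi; hence the
    derivative of e^(-zt) K(D) phi is - e^(-zt) N(D) phi.  Real parts suffice:
    [y = 0] gives the Laplace transform and [x = 0] the cosine transform. *)
Lemma rational_kernel_transform (x y : R) : 0 <= x ->
  mu.-integrable half_line
    (EFin \o
      (fun t => expR (- (x * t)) * cos (y * t) * rational_kernel h N t)) /\
  \int[mu]_(t in half_line)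
    (expR (- (x * t)) * cos (y * t) * rational_kernel h N t) =
  complex.Re (ceval N (x +i* y) / ceval P (x +i* y)).
Proof.
move=> x0; have [K KE K0] := @partial_fraction_quotient (x +i* y) x0.
set c := ceval N _ / _ in KE K0 *.
pose g := rational_kernel h N.
pose a t := complex.Re (diffop K t); pose b t := complex.Im (diffop K t).
have KX t : diffop (K * 'X) t = (x +i* y) * diffop K t - (g t)%:C.
  have -> : K * 'X = (x +i* y) *: K + (c *: toC P + (-1) *: toC N).
    by rewrite scaleN1r KE mulrBr [K * (x +i* y)%:P]mulrC mul_polyC addrC subrK.
  have P0 : diffop (toC P) t = 0.
    by rewrite -[toC P]mulr1 (diffop_annihilate mP hP).
  by rewrite !diffopD !diffopZ P0 mulr0 add0r mulN1r diffop_real.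
have da (t : R) : is_derive t 1 a (x * a t - y * b t - g t).
  have := is_derive_Re_diffop mP hP K t; rewrite KX /a /b.
  by case: (diffop K t).
have db (t : R) : is_derive t 1 b (x * b t + y * a t).
  have := is_derive_Im_diffop mP hP K t; rewrite KX /a /b.
  by case: (diffop K t) => u v /=; rewrite subr0.
pose F t := expR (- (x * t)) * cos (y * t) * g t.
(* the real part of e^(-zt) K(D) phi *)
pose W t := expR (- (x * t)) * (cos (y * t) * a t + sin (y * t) * b t).
have dW (t : R) : is_derive t 1 W (- F t).
  have dat := da t; have dbt := db t.
  by apply: is_derive_eq; rewrite /GRing.scale/= /F; ring.
have [C [e [e0 gC]]] := diffop_exp_decay mP hP stableP (toC N).
have [C' [e' [e'0 KC]]] := diffop_exp_decay mP hP stableP K.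
have e20 : 0 < e / 2 by lra.
have ex1 t : 0 <= t -> 0 <= expR (- (x * t)) <= 1.
  by move=> t0; rewrite expR_ge0 -expR0 ler_expR oppr_le0 mulr_ge0.
have FB t : 0 <= t -> `|F t| <= (1 + `|C|) * expR (- (e / 2 * t)).
  move=> t0; apply: (@le_trans _ _ `|g t|).
    rewrite /F normrM ler_piMl// normrM mulr_ile1//.
      by case/andP: (ex1 t t0) => *; rewrite ger0_norm.
    by rewrite ler_norml cos_le1 cos_geN1.
  apply: sqr_le_expRN; have := gC t t0.
  by rewrite /= diffop_real /sqnorm /= expr0n addr0.
have WB t : 0 <= t -> `|W t| <= (1 + `|C'|) * expR (- (e' / 2 * t)).
  move=> t0; apply: sqr_le_expRN; apply: le_trans (KC t t0).
  rewrite /sqnorm /= -/(a t) -/(b t) /W exprMn.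
  apply: (@le_trans _ _ ((cos (y * t) * a t + sin (y * t) * b t) ^+ 2)).
    by rewrite ler_piMl ?sqr_ge0// exprn_ile1//; case/andP: (ex1 t t0).
  rewrite -subr_ge0.
  have -> : a t ^+ 2 + b t ^+ 2 - (cos (y * t) * a t + sin (y * t) * b t) ^+ 2 =
      (sin (y * t) * a t - cos (y * t) * b t) ^+ 2.
    by have := sin2cos2 (y * t); have := cos2sin2 (y * t); nra.
  exact: sqr_ge0.
have W0 : W t @[t --> +oo] --> 0.
  have e20' : 0 < e' / 2 by lra.
  have B0 : (1 + `|C'|) * expR (- (e' / 2 * t)) @[t --> +oo] --> 0.
    rewrite -(mulr0 (1 + `|C'|)).
    by apply: cvgM; [exact: cvg_cst|exact: cvgy_expRN].
  apply: norm_cvg0; apply: (squeeze_cvgr _ (cvg_cst 0) B0).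
  near=> t; rewrite normr_ge0/=; apply: WB.
  by near: t; exact: nbhs_pinfty_ge.
have cF : continuous F.
  have dE (t : R) : is_derive t 1 (fun t => expR (- (x * t)) * cos (y * t))
      (- (x * expR (- (x * t)) * cos (y * t)) -
       y * (expR (- (x * t)) * sin (y * t))).
    by apply: is_derive_eq; rewrite /GRing.scale/=; ring.
  have cE : continuous (fun t => expR (- (x * t)) * cos (y * t)).
    move=> t; apply: differentiable_continuous; apply/derivable1_diffP.
    by have [] := dE t.
  by move=> t; exact: cvgM (cE t) (@continuous_rational_kernel t).
have [iF ->] := integral_antiderivative e20 cF FB dW W0.
by split=> //; rewrite /W !mulr0 oppr0 expR0 cos0 sin0 /a K0; ring.
Unshelve. all: by end_near. Qed.

End rational_transform.

(** * CARMA kernels *)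

Section carma_kernels.
Context {R : realType}.
Implicit Types P Q N : {poly R}.
Notation mu := (@lebesgue_measure R).
Notation half_line := (`[0%R, +oo[%classic : set R).

Lemma exists_impulse_response P : P \is monic ->
  exists h, impulse_response P h.
Proof.
move=> mP; have [n0|n0] := posnP (size P).-1; last first.
  by exists (companion_impulse n0); exact: companion_impulse_response.
exists (fun=> 0); split=> [k|j]; last by rewrite n0.
by rewrite big1// => j _; rewrite mulr0.
Qed.

Lemma ceval_real P (x : R) : ceval P (x +i* 0) = (P.[x])%:C.
Proof. by rewrite /ceval -[x +i* 0]/(real_complex R x) horner_map. Qed.

Lemma stable_horner_neq0 P (x : R) : no_zero_in_Cplus P -> 0 <= x -> P.[x] != 0.
Proof.
move=> sP x0; have := sP (x +i* 0) x0; rewrite ceval_real.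
by apply: contra => /eqP ->.
Qed.

(** A monic polynomial is positive at infinity, and [P] does not change sign on
    [[0, +oo[] for want of zeroes. *)
Lemma stable_horner_gt0 P (x : R) : P \is monic -> no_zero_in_Cplus P ->
  0 <= x -> 0 < P.[x].
Proof.
move=> mP sP x0; rewrite -sgr_gt0.
rewrite (@polyrcf.sgp_pinftyP R 0 P).
- by rewrite /polyrcf.sgp_pinfty (monicP mP) sgr1.
- by move=> y; rewrite in_itv/= andbT => y0; rewrite /root stable_horner_neq0.
- by rewrite in_itv/= andbT.
Qed.

Lemma laplace_rational_kernel P N h (x : R) : P \is monic ->
  impulse_response P h -> no_zero_in_Cplus P -> (size N <= (size P).-1)%N ->
  0 <= x -> exp_moment (rational_kernel h N) 0 x = N.[x] / P.[x].
Proof.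
move=> mP hP sP sN x0.
have [_] := rational_kernel_transform mP hP sP sN 0 x0.
rewrite !ceval_real -fmorph_div/= => <-; apply: eq_Rintegral => t _.
by rewrite mul0r cos0 mulr1 expr0 mul1r.
Qed.

Lemma integrable_rational_kernel P N h : P \is monic ->
  impulse_response P h -> no_zero_in_Cplus P -> (size N <= (size P).-1)%N ->
  mu.-integrable half_line (EFin \o rational_kernel h N).
Proof.
move=> mP hP sP sN.
have [+ _] := rational_kernel_transform mP hP sP sN 0 (lexx 0).
apply: eq_integrable => // t _ /=.
by rewrite !mul0r oppr0 expR0 cos0 !mul1r.
Qed.

Lemma rational_kernel_ge0 P N h : P \is monic ->
  impulse_response P h -> no_zero_in_Cplus P -> (size N <= (size P).-1)%N ->
  completely_monotone (fun x => N.[x] / P.[x]) ->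
  forall t, 0 <= t -> 0 <= rational_kernel h N t.
Proof.
move=> mP hP sP sN.
apply: (bernstein_half_line (integrable_rational_kernel mP hP sP sN) _ _).1.
  exact/continuous_subspaceT/(continuous_rational_kernel (N := N) mP hP).
by move=> x x0; rewrite (laplace_rational_kernel mP hP sP sN (ltW x0)).
Qed.

Lemma carma_kernel_rational P Q (n0 : (0 < (size P).-1)%N) (t : R) :
  size Q = (size P).-1 ->
  carma_kernel P Q t = rational_kernel (companion_impulse n0) Q t.
Proof.
by move=> sQ; rewrite (carma_kernelE n0) /rational_kernel sQ.
Qed.

(** The real parts of the Fourier transforms are cosine transforms, and these
    agree by [rational_kernel_transform] at [x = 0]. *)
Lemma half_line_fourier_unique P N h (f : R -> R) : P \is monic ->
  impulse_response P h -> no_zero_in_Cplus P -> (size N <= (size P).-1)%N ->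
  {within half_line, continuous f} -> mu.-integrable half_line (EFin \o f) ->
  (forall y : R,
    half_line_fourier f y = ceval N (0 +i* y) / ceval P (0 +i* y)) ->
  forall t, 0 <= t -> f t = rational_kernel h N t.
Proof.
move=> mP hP sP sN cf intf fF t t0.
have mD := @measurable_half_line R.
have intg := integrable_rational_kernel mP hP sP sN.
apply/eqP; rewrite -subr_eq0; apply/eqP.
apply: (eq0_of_cosine_transform (k := fun t => f t - rational_kernel h N t)) t0.
- exact: (integrableB mD intf intg).
- move=> y.
  have [] := rational_kernel_transform mP hP sP sN y (lexx 0).
  have E s : expR (- (0 * s)) * cos (y * s) * rational_kernel h N s =
      cos (y * s) * rational_kernel h N s by rewrite mul0r oppr0 expR0 mul1r.
  move=> iyg Iyg.
  have {}Iyg : \int[mu]_(s in half_line) (cos (y * s) * rational_kernel h N s) =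
     complex.Re (ceval N (0 +i* y) / ceval P (0 +i* y)).
    by rewrite -Iyg; apply: eq_Rintegral => s _; rewrite E.
  have Iyf : \int[mu]_(s in half_line) (cos (y * s) * f s) =
     complex.Re (ceval N (0 +i* y) / ceval P (0 +i* y)).
    rewrite -fF /half_line_fourier /Cintegral /=; apply: eq_Rintegral => s _.
    by rewrite mulr0 subr0 cosN [s * y]mulrC.
  have mcos : measurable_fun half_line (fun s : R => cos (y * s)).
    apply: measurable_funTS; apply: continuous_measurable_fun => s.
    apply: continuous_comp; last exact: continuous_cos.
    exact: mulrl_continuous.
  have iyf : mu.-integrable half_line (EFin \o (fun s => cos (y * s) * f s)).
    apply: (@integrable_boundedM _ _ _ _ _ _ _ 1) => // s _.
    by rewrite ler_norml cos_le1 cos_geN1.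
  have {}iyg : mu.-integrable half_line
      (EFin \o (fun s => cos (y * s) * rational_kernel h N s)).
    by apply: eq_integrable iyg => // s _ /=; rewrite E.
  under eq_Rintegral do rewrite mulrBr.
  by rewrite RintegralB// Iyf Iyg subrr.
- have cg : {within half_line, continuous (rational_kernel h N)}.
    exact/continuous_subspaceT/(continuous_rational_kernel (N := N) mP hP).
  by move=> s; apply: cvgB; [exact: cf|exact: cg].
Qed.

(** By definition of the remainder, [P / Q = x + l - R / Q]. *)
Lemma completely_monotone_carma P Q (l : R) :
  P \is monic -> Q \is monic -> no_zero_in_Cplus P -> no_zero_in_Cplus Q ->
  completely_monotone (fun x => (remainder P Q l).[x] / Q.[x]) ->
  completely_monotone (fun x => Q.[x] / P.[x]).
Proof.
move=> mP mQ sP sQ /completely_monotoneP cmR; apply/completely_monotoneP => n.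
have E x : 0 < x -> x + l - (remainder P Q l).[x] / Q.[x] = P.[x] / Q.[x].
  move=> x0; have Q0 : Q.[x] != 0 by rewrite stable_horner_neq0// ltW.
  by rewrite /remainder !hornerE; field.
have B0 x : 0 < x -> 0 < x + l - (remainder P Q l).[x] / Q.[x].
  by move=> x0; rewrite E// divr_gt0// stable_horner_gt0// ltW.
apply: eq_cm_upto (cm_upto_recip cmR B0 n) => x x0.
by rewrite E// invf_div.
Qed.

Lemma Rintegral_carma_ge0 (F : cumulative R R) (g : R -> R) (t : R) :
  (forall s, 0 <= s -> 0 <= g s) ->
  0 <= \int[lebesgue_stieltjes_measure F]_(s in `]-oo, t]) g (t - s).
Proof.
move=> g0; apply: Rintegral_ge0 => s; rewrite /= in_itv/= => st.
by apply: g0; rewrite subr_ge0.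
Qed.

End carma_kernels.

Unset Implicit Arguments.

Theorem theorem3p1 (R : realType) (d : measure_display)
    (Omega : measurableType d) (Pr : probability Omega R)
    (p : nat) (P Q : {poly R}) (L Y : R -> Omega -> R)
    (gamma : R) (nu : {measure set R -> \bar R}) (lambda : R) (f : R -> R)
    (p_gt0 : (0 < p)%N)
    (P_monic : P \is monic) (Q_monic : Q \is monic)
    (sizeP : size P = p.+1) (sizeQ : size Q = p)
    (P_causal : no_zero_in_Cplus P) (Q_invertible : no_zero_in_Cplus Q)
    (L_sub : two_sided_subordinator Pr L)
    (L_levy : drift_levy_measure Pr L gamma nu)
    (nu_neq0 : nu [set: R] <> 0%E)
    (L_mean : ('E_Pr[L 1%R] < +oo)%E)
    (Y_carma : carma_process Pr P Q L Y)
    (deg_remainder : (size (remainder P Q lambda) < p)%N)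
    (f_continuous : {within `[0, +oo[, continuous f})
    (f_integrable :
      lebesgue_measure.-integrable `[0, +oo[ (fun t => (f t)%:E))
    (f_fourier : forall y : R, half_line_fourier f y =
      ceval (remainder P Q lambda) (0 +i* y) / ceval Q (0 +i* y)) :
  let RQ := fun x : R => (remainder P Q lambda).[x] / Q.[x] in
  (completely_monotone RQ <-> (forall t, 0 <= t -> 0 <= f t)) /\
  (completely_monotone RQ -> nonnegative_process Pr Y).

Proof.
have sN : (size (remainder P Q lambda) <= (size Q).-1)%N.
  by rewrite sizeQ -ltnS prednK.
have [h hQ] := exists_impulse_response Q_monic.
have fE := half_line_fourier_unique Q_monic hQ Q_invertible sN
  f_continuous f_integrable f_fourier.
split.
  apply: (bernstein_half_line f_integrable f_continuous) => x x0.
  rewrite -(laplace_rational_kernel Q_monic hQ Q_invertible sN (ltW x0)).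
  apply: eq_Rintegral => t; rewrite inE /= in_itv/= andbT => t0.
  by rewrite fE.
move=> cmR t.
have n0 : (0 < (size P).-1)%N by rewrite sizeP.
have sQ : size Q = (size P).-1 by rewrite sizeP sizeQ.
have g0 s : 0 <= s -> 0 <= carma_kernel P Q s.
  rewrite (carma_kernel_rational n0 _ sQ).
  apply: (rational_kernel_ge0 P_monic
    (companion_impulse_response P_monic n0) P_causal).
    by rewrite sQ.
  exact: completely_monotone_carma cmR.
move: (Y_carma t); apply: filterS => w [F [_ _ ->]].
exact: Rintegral_carma_ge0.
Qed.
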